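(* Let $\mathcal{F}$ be a Furstenberg family such that $\mathrm{span}(\mathcal{E}(S))\subset\mathcal{F}\mathrm{Rec}(S)$ for every continuous linear operator $S$ on a real or complex separable infinite-dimensional F-space. Then for every continuous linear operator $T$ on a real or complex separable infinite-dimensional F-space $X$ which is $\mathcal{F}$-recurrent, there exists an infinite-dimensional $T$-invariant vector subspace $Z\subset X$ with $Z^N\subset\mathcal{F}\mathrm{Rec}(T_{(N)})$ for every $N\in\mathbb{N}$. In particular this applies when $\mathcal{F}$ is any of: the infinite sets $\mathcal{I}$, $\mathcal{AP}$, $\overline{\mathcal{BD}}$, $\overline{\mathcal{D}}$, $\underline{\mathcal{D}}$, $\mathcal{S}$, $\mathcal{IP}^*$, $\Delta^*$; so for an operator that is recurrent (resp. $\mathcal{F}$-recurrent for one of these families) the corresponding set of recurrent vectors contains an infinite-dimensional $T$-invariant subspace.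
   Context: A Furstenberg family is a collection $\mathcal{F}$ of infinite subsets of $\mathbb{N}_0$, closed under supersets, with $A\cap[n,\infty)\in\mathcal{F}$ whenever $A\in\mathcal{F}$, $n\in\mathbb{N}$. $\mathcal{F}\mathrm{Rec}(T)$ is the set of $x$ with $\{n\geq0:T^nx\in U\}\in\mathcal{F}$ for each neighbourhood $U$ of $x$; $T$ is $\mathcal{F}$-recurrent if this set is dense. $\mathcal{E}(T)$: in the complex case, nonzero $x$ with $Tx=\lambda x$, $|\lambda|=1$; in the real case, those $x$ such that $x+iy$ is such an eigenvector of the complexification $\widetilde T(x+iy)=Tx+iTy$ for some $y$. $T_{(N)}=T\oplus\cdots\oplus T$ on $X^N$. Families: $\mathcal{I}$ infinite sets; $\mathcal{AP}$ sets containing arithmetic progressions of every finite length; $\overline{\mathcal{BD}}$, $\overline{\mathcal{D}}$, $\underline{\mathcal{D}}$ sets of positive upper Banach, upper, lower density; $\mathcal{S}$ syndetic sets (bounded gaps); $\mathcal{IP}^*$ sets meeting every IP-set $\{\sum_{k\in F}n_k: F\subset\mathbb{N} \text{ finite nonempty}\}$; $\Delta^*$ sets meeting every $(B-B)\cap\mathbb{N}$ with $B$ infinite. *)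

(* Defs.v *)
From HB Require Import structures.
From mathcomp Require Import all_boot all_order all_algebra.
From mathcomp Require Import all_classical all_reals all_analysis.
From mathcomp Require Import complex.
Set Implicit Arguments.
Unset Strict Implicit.
Unset Printing Implicit Defensive.
Import Order.TTheory GRing.Theory Num.Theory.
Local Open Scope classical_set_scope.
Local Open Scope ring_scope.

Definition infinite_nat (A : set nat) : Prop := ~ finite_set A.

Definition Furstenberg_family (F : set (set nat)) : Prop :=
  [/\ (forall A, F A -> infinite_nat A),
      (forall A B, F A -> A `<=` B -> F B) &
      (forall A (n : nat), (0 < n)%N -> F A -> F (A `&` [set m | (n <= m)%N]))].

Definition FRec (F : set (set nat)) (Y : topologicalType) (T : Y -> Y) : set Y :=
  [set x | forall U : set Y, nbhs x U -> F [set n : nat | U (iter n T x)]].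

Definition F_recurrent (F : set (set nat)) (Y : topologicalType) (T : Y -> Y) :=
  dense (FRec F T).

Definition lin_span (K : pzRingType) (X : lmodType K) (A : set X) : set X :=
  [set x | exists (n : nat) (v : 'I_n -> X) (c : 'I_n -> K),
      (forall i, A (v i)) /\ x = \sum_(i < n) c i *: v i].

Definition is_subspace (K : pzRingType) (X : lmodType K) (Z : set X) : Prop :=
  Z 0 /\ (forall (a : K) (x y : X), Z x -> Z y -> Z (a *: x + y)).

Definition infinite_dimensional (K : pzRingType) (X : lmodType K) (Z : set X)
  : Prop :=
  forall (n : nat) (v : 'I_n -> X), ~ (Z `<=` lin_span (range v)).

Definition T_invariant (X : Type) (T : X -> X) (Z : set X) : Prop :=
  forall z, Z z -> Z (T z).

Definition cont_lin_op (K : numDomainType) (X : topologicalLmodType K)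
  (T : X -> X) : Prop :=
  (forall (a : K) (x y : X), T (a *: x + y) = a *: T x + T y) /\ continuous T.

Definition F_space (R : realType) (K : numDomainType) (X : topologicalLmodType K)
  : Prop :=
  exists d : X -> X -> R,
    [/\ (forall x y, 0 <= d x y) /\ (forall x y, d x y = 0 <-> x = y),
        (forall x y, d x y = d y x),
        (forall x y z, d x z <= d x y + d y z),
        (forall x y z, d (x + z) (y + z) = d x y) &
        (forall (x : X) (U : set X),
            nbhs x U <-> exists e : R, 0 < e /\ [set y | d x y < e] `<=` U) /\
        (forall u : nat -> X,
            (forall e : R, 0 < e -> exists N : nat, forall m n : nat,
                (N <= m)%N -> (N <= n)%N -> d (u m) (u n) < e) ->
            exists l : X, forall e : R, 0 < e -> exists N : nat,
                forall n : nat, (N <= n)%N -> d (u n) l < e)].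

Definition separable (Y : topologicalType) : Prop :=
  exists u : nat -> Y, dense (range u).

Definition sep_inf_F_space (R : realType) (K : numDomainType)
  (X : topologicalLmodType K) : Prop :=
  [/\ F_space R X, separable X & infinite_dimensional [set: X]].

Definition E_complex (R : realType) (X : lmodType R[i]) (T : X -> X) : set X :=
  [set x | x != 0 /\ exists l : R[i], `|l| = 1 /\ T x = l *: x].

(* real case: x such that x + i y is a unimodular eigenvector of the
   complexification  T~(x + i y) = T x + i T y  for some y, i.e.
   (x, y) <> (0, 0) and, for lambda = a + i b with a^2 + b^2 = 1,
   T x + i T y = (a x - b y) + i (b x + a y). *)
Definition E_real (R : realType) (X : lmodType R) (T : X -> X) : set X :=
  [set x | exists y : X, (x != 0 \/ y != 0) /\
     exists a b : R, a ^+ 2 + b ^+ 2 = 1 /\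
       T x = a *: x - b *: y /\ T y = b *: x + a *: y].

Definition span_E_in_FRec (R : realType) (F : set (set nat)) : Prop :=
  (forall (X : topologicalLmodType R), sep_inf_F_space R X ->
     forall S : X -> X, cont_lin_op S -> lin_span (E_real S) `<=` FRec F S)
  /\
  (forall (X : topologicalLmodType R[i]), sep_inf_F_space R X ->
     forall S : X -> X, cont_lin_op S -> lin_span (E_complex S) `<=` FRec F S).

Definition T_N (X : topologicalType) (T : X -> X) (N : nat)
  : {ptws 'I_N -> X} -> {ptws 'I_N -> X} :=
  fun v i => T (v i).

Definition recurrent_subspace_conclusion (R : realType) (K : numDomainType)
  (F : set (set nat)) : Prop :=
  forall (X : topologicalLmodType K), sep_inf_F_space R X ->
  forall T : X -> X, cont_lin_op T -> F_recurrent F T ->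
  exists Z : set X,
    [/\ is_subspace Z, infinite_dimensional Z, T_invariant T Z &
        forall (N : nat) (z : {ptws 'I_N.+1 -> X}),
          (forall i, Z (z i)) -> FRec F (@T_N X T N.+1) z].

Definition recurrent_subspace_RC (R : realType) (F : set (set nat)) : Prop :=
  recurrent_subspace_conclusion R R F /\ recurrent_subspace_conclusion R R[i] F.

Definition count_in (A : set nat) (m N : nat) : nat :=
  (\sum_(m <= k < m + N) (`[< A k >] : nat))%N.

Definition fam_I : set (set nat) := [set A | infinite_nat A].

Definition fam_AP : set (set nat) :=
  [set A | forall k : nat, exists a d : nat, (0 < d)%N /\
      forall j : nat, (j < k)%N -> A (a + j * d)%N].

(* positive upper Banach density:
   limsup_N max_m #(A \cap [m, m+N)) / N > 0 *)
Definition fam_BDbar : set (set nat) :=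
  [set A | exists2 delta : rat, 0 < delta &
     forall N0 : nat, exists N : nat, [/\ (N0 <= N)%N, (0 < N)%N &
       exists m : nat, delta * N%:R <= (count_in A m N)%:R]].

(* positive upper density: limsup_N #(A \cap [0, N)) / N > 0 *)
Definition fam_Dbar : set (set nat) :=
  [set A | exists2 delta : rat, 0 < delta &
     forall N0 : nat, exists N : nat, [/\ (N0 <= N)%N, (0 < N)%N &
       delta * N%:R <= (count_in A 0 N)%:R]].

(* positive lower density: liminf_N #(A \cap [0, N)) / N > 0 *)
Definition fam_Dunder : set (set nat) :=
  [set A | exists2 delta : rat, 0 < delta &
     exists N0 : nat, forall N : nat, (N0 <= N)%N ->
       delta * N%:R <= (count_in A 0 N)%:R].

Definition fam_S : set (set nat) :=
  [set A | exists g : nat, (0 < g)%N /\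
     forall m : nat, exists n : nat, (m <= n < m + g)%N /\ A n].

Definition fam_IPstar : set (set nat) :=
  [set A | forall n : nat -> nat, (forall k, (0 < n k)%N) ->
     exists s : seq nat, [/\ s != [::], uniq s & A (\sum_(k <- s) n k)%N]].

Definition fam_Deltastar : set (set nat) :=
  [set A | forall B : set nat, infinite_nat B ->
     exists b1 b2 : nat, [/\ B b1, B b2, (b1 < b2)%N & A (b2 - b1)%N]].

(* Main.v *)
Require Import Defs.
From HB Require Import structures.
From mathcomp Require Import all_boot all_order all_algebra.
From mathcomp Require Import all_classical all_reals all_analysis.
From mathcomp Require Import complex.
From mathcomp Require Import zify ring lra.
Set Implicit Arguments.
Unset Strict Implicit.
Unset Printing Implicit Defensive.
Import Order.TTheory GRing.Theory Num.Theory.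
Local Open Scope classical_set_scope.
Local Open Scope ring_scope.

(** If some F-recurrent vector x is annihilated by no nonzero polynomial in T, then
    Z = { p(T) x } works, because y |-> (p_1(T) y, ..., p_N(T) y) is continuous and intertwines T
    with T_(N).  Otherwise every F-recurrent vector x lies in a finite-dimensional invariant
    subspace; recurrence forces the eigenvalues seen by x to be unimodular and excludes Jordan
    blocks, so x belongs to span(E(T)), after complexification in the real case.  Hence
    Z = span(E(T)) is dense, and it is infinite-dimensional since finite-dimensional subspaces are
    closed.  Coordinatewise, Z^N lies in span(E(T_(N))), to which the hypothesis on F applies.

    For the concrete families, a linear combination of unimodular eigenvectors returns close to
    itself along a Bohr set { k : |l_i^k - 1| < e for all i }.  By the pigeonhole principle on the
    torus a Bohr set is Deltastar, hence it belongs to all the families except possibly AP, and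
    a positive element d of a smaller Bohr set gives the progression d, 2d, ..., kd. *)

(* The norm of [R[i]] takes its values in [R[i]], where the order is partial; a real-valued norm
   allows a uniform treatment of the scalar fields [R] and [R[i]]. *)
Record scalar_norm (R : realType) (K : numFieldType) (N : K -> R) : Prop := {
  snormM : forall a b, N (a * b) = N a * N b;
  snormD : forall a b, N (a + b) <= N a + N b;
  snormN : forall a, N (- a) = N a;
  snorm_nat : forall n : nat, N n%:R = n%:R;
  snorm_eq0 : forall a, N a = 0 -> a = 0;
  snorm_small : forall e : K, 0 < e ->
    exists2 d : R, 0 < d & forall z, N z < d -> `|z| < e;
  snorm_complete : forall c : nat -> K,
    (forall m n, (m <= n)%N -> N (c m - c n) <= m.+1%:R^-1) ->
    exists l, forall n, N (c n - l) <= 2 * n.+1%:R^-1 }.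

(** * Real-valued norms on the scalars *)

Section ScalarNorm.
Variables (R : realType) (K : numFieldType) (N : K -> R) (hN : scalar_norm N).

Lemma snorm0 : N 0 = 0. Proof. exact: (snorm_nat hN 0). Qed.
Lemma snorm1 : N 1 = 1. Proof. exact: (snorm_nat hN 1). Qed.

Lemma snorm_ge0 a : 0 <= N a.
Proof. by have := snormD hN a (- a); rewrite subrr snorm0 snormN //; lra. Qed.

Lemma snorm_gt0 a : a != 0 -> 0 < N a.
Proof.
move=> a0; rewrite lt_def snorm_ge0 andbT; apply: contra a0 => /eqP h.
by rewrite (snorm_eq0 hN h).
Qed.

Lemma snormB_ge a b : N a - N b <= N (a - b).
Proof. by have := snormD hN (a - b) b; rewrite subrK; lra. Qed.

Lemma snormB_sym a b : N (a - b) = N (b - a).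
Proof. by rewrite -(snormN hN) opprB. Qed.

Lemma snormV a : N a^-1 = (N a)^-1.
Proof.
have [->|a0] := eqVneq a 0; first by rewrite invr0 snorm0 invr0.
apply: (mulIf (lt0r_neq0 (snorm_gt0 a0))).
by rewrite -(snormM hN) !mulVf ?snorm1// (lt0r_neq0 (snorm_gt0 a0)).
Qed.

Lemma snormX a n : N (a ^+ n) = N a ^+ n.
Proof. by elim: n => [|n IH]; rewrite ?snorm1// !exprS (snormM hN) IH. Qed.

End ScalarNorm.

Lemma inv_nat_lt (R : realType) (e : R) : 0 < e -> exists n : nat, n.+1%:R^-1 < e.
Proof.
move=> e0; exists (Num.bound e^-1).
have h : e^-1 < (Num.bound e^-1).+1%:R.
  by apply: lt_trans (archi_boundP _) _; rewrite ?invr_ge0 ?ltW// ltr_nat.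
by rewrite -[ltRHS]invrK ltf_pV2// posrE ?invr_gt0// ltr0n.
Qed.

(** * Closed subspaces and finite-dimensional spans of topological modules *)

Section TopologicalModule.
Variables (R : realType) (K : numFieldType) (N : K -> R) (hN : scalar_norm N).
Variable X : topologicalLmodType K.
Implicit Types (U V W : set X) (x y v : X).

Lemma nbhs_add x y U : nbhs (x + y) U ->
  exists V W, [/\ nbhs x V, nbhs y W & forall a b, V a -> W b -> U (a + b)].
Proof.
move=> nU; have /= := @add_continuous X (x, y) U nU.
by move=> [[V W] [/= nV nW] h]; exists V, W; split=> // a b Va Wb; apply: (h (a, b)).
Qed.

Lemma nbhs_scale (a : K) x U : nbhs (a *: x) U ->
  exists d V, [/\ 0 < d :> R, nbhs x V & forall b y, N (b - a) < d -> V y -> U (b *: y)].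
Proof.
move=> nU; have /= := @scale_continuous K X (a, x) U nU.
move=> [[B V] [/= nB nV] h].
have [/= e e0 hB] : exists2 e : K, 0 < e & forall z, `|a - z| < e -> B z.
  by case: nB => /= e e0 he; exists e => // z hz; apply: he.
have [d d0 hd] := snorm_small hN e0.
exists d, V; split=> // b y hb Vy; apply: (h (b, y)); split=> //=; apply: hB.
by apply: hd; rewrite (snormB_sym hN).
Qed.

Lemma nbhs_translate x y U : nbhs (x + y) U -> nbhs y [set z | U (x + z)].
Proof.
move=> /nbhs_add[V [W [nV nW h]]]; apply: filterS nW => z Wz.
by apply: h => //; exact: nbhs_singleton.
Qed.

Lemma nbhs_dilate (a : K) x U : nbhs (a *: x) U -> nbhs x [set z | U (a *: z)].
Proof.
move=> /nbhs_scale[d [V [d0 nV h]]]; apply: filterS nV => z Vz.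
by apply: h; rewrite // subrr (snorm0 hN).
Qed.

Lemma nbhs0_sub x U : nbhs x U -> nbhs 0 [set z | U (x + z)].
Proof. by rewrite -{1}[x]addr0 => /nbhs_translate. Qed.

Lemma nbhs_shift x U : nbhs 0 U -> nbhs x [set z | U (z - x)].
Proof.
rewrite -{1}(addNr x) => /nbhs_translate h.
by apply: filterS h => z /=; rewrite addrC.
Qed.

Lemma nbhs0_comb n (v : 'I_n -> X) U : nbhs 0 U -> exists2 e : R, 0 < e &
  forall a : 'I_n -> K, (forall i, N (a i) < e) -> U (\sum_(i < n) a i *: v i).
Proof.
elim: n v U => [|n IH] v U nU.
  by exists 1 => // a _; rewrite big_ord0; exact: nbhs_singleton.
have := nU; rewrite -{1}(addr0 0) => /nbhs_add[V [W [nV nW h]]].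
have [e1 e10 h1] := IH (v \o lift ord0) W nW.
have := nV; rewrite -{1}(scale0r (v ord0)) => /nbhs_scale[e2 [V' [e20 nV' h2]]].
exists (Num.min e1 e2); first by rewrite lt_min e10.
move=> a ha; rewrite big_ord_recl; apply: h.
  apply: h2; last exact: nbhs_singleton.
  by rewrite subr0; have := ha ord0; rewrite lt_min => /andP[].
apply: (h1 (a \o lift ord0)) => i /=.
by have := ha (lift ord0 i); rewrite lt_min => /andP[].
Qed.

Definition subspace_plus W v : set X := [set x | exists w c, W w /\ x = w + c *: v].

Lemma subspaceZ W c x : is_subspace W -> W x -> W (c *: x).
Proof. by move=> [W0 h] Wx; rewrite -[c *: x]addr0; apply: h. Qed.

Lemma subspaceD W x y : is_subspace W -> W x -> W y -> W (x + y).
Proof. by move=> [W0 h] Wx Wy; rewrite -[x]scale1r; apply: h. Qed.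

Lemma subspaceB W x y : is_subspace W -> W x -> W y -> W (x - y).
Proof. by move=> sW Wx Wy; apply: subspaceD => //; rewrite -scaleN1r; apply: subspaceZ. Qed.

Lemma subspace_sum W n (f : 'I_n -> X) : is_subspace W -> (forall i, W (f i)) ->
  W (\sum_(i < n) f i).
Proof.
move=> sW h; elim/big_ind: _ => //; first by case: sW.
by move=> x y; apply: subspaceD.
Qed.

(* The coordinate along v is a functional with closed kernel W, hence continuous. *)
Lemma coord_small W v (e : R) : is_subspace W -> closed W -> ~ W v -> 0 < e ->
  exists2 U, nbhs 0 U & forall w c, W w -> U (w + c *: v) -> N c < e.
Proof.
move=> sW cW Wv e0.
have nW : nbhs v (~` W) by apply: open_nbhs_nbhs; split => //; exact: closed_openC.
have := nbhs0_sub nW => /= n0.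
have := n0; rewrite -{1}(scale0r (0 : X)) => /nbhs_scale[d [V [d0 nV h]]].
have [k hk] := inv_nat_lt (mulr_gt0 e0 d0).
have nU : nbhs 0 [set z | V (k.+1%:R *: z)] by apply: nbhs_dilate; rewrite scaler0.
exists [set z | V (k.+1%:R *: z)] => // w c Ww /= hV.
rewrite ltNge; apply/negP => ec.
have c0 : c != 0.
  by apply/eqP => c0; move: ec; rewrite c0 (snorm0 hN); lra.
have Nc := snorm_gt0 hN c0.
have k0 : (k.+1%:R : K) != 0 by rewrite pnatr_eq0.
(* The scalar [(k.+1 c)^-1] has norm below [d], because [k.+1^-1 < e d <= d N(c)]. The vector
   displayed equals [- c^-1 w], which lies in [W]: a contradiction. *)
have : (~` W) (v + (- (k.+1%:R * c)^-1) *: (k.+1%:R *: (w + c *: v))).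
  apply: h => //; rewrite subr0 (snormN hN) (snormV hN) (snormM hN) (snorm_nat hN).
  rewrite -[ltRHS]invrK ltf_pV2 ?posrE ?invr_gt0 ?mulr_gt0 ?ltr0n//.
  rewrite -[ltLHS]mul1r ltr_pdivrMr//.
  rewrite -(@ltr_pM2l _ k.+1%:R^-1) ?invr_gt0 ?ltr0n// mulr1.
  rewrite !mulrA mulVf ?pnatr_eq0// mul1r.
  by apply: lt_le_trans hk _; rewrite ler_wpM2r// ltW.
rewrite scalerA mulNr invfM [k.+1%:R^-1 * _]mulrC mulfVK// scalerDr scalerA mulNr mulVf//.
rewrite scaleN1r addrC -addrA addNr addr0; apply.
exact: subspaceZ.
Qed.

Lemma subspace_plus_subspace W v : is_subspace W -> is_subspace (subspace_plus W v).
Proof.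
move=> sW; split; first by exists 0, 0; rewrite scale0r addr0; split=> //; case: sW.
move=> a x y [w [c [Ww ->]]] [w' [c' [Ww' ->]]].
exists (a *: w + w'), (a * c + c'); split; first by case: sW => _; apply.
by rewrite scalerDr scalerDl scalerA addrACA.
Qed.

Lemma closedP_nbhs (A : set X) :
  (forall x, (forall U, nbhs x U -> exists2 y, U y & A y) -> A x) -> closed A.
Proof.
move=> h x cx; apply: h => U nU; have [y [Ay Uy]] := cx U nU.
by exists y.
Qed.

(** By [coord_small], points of [W + K v] close to x have v-coordinates close to each other. These
    coordinates converge to a scalar l by completeness, and [x - l v] is adherent to the closed
    subspace [W]. *)
Lemma subspace_plus_closed W v :
  is_subspace W -> closed W -> closed (subspace_plus W v).
Proof.
move=> sW cW; have [Wv|Wv] := pselect (W v).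
  suff -> : subspace_plus W v = W by [].
  apply/seteqP; split=> [x [w [c [Ww ->]]]|x Wx].
    by apply: subspaceD => //; apply: subspaceZ.
  by exists x, 0; rewrite scale0r addr0.
apply: closedP_nbhs => x hx.
have nearx (k : nat) : exists V, nbhs x V /\ forall w c w' c', W w -> W w' ->
    V (w + c *: v) -> V (w' + c' *: v) -> N (c - c') <= k.+1%:R^-1.
  have [|U nU hU] := @coord_small W v k.+1%:R^-1 sW cW Wv; first by rewrite invr_gt0.
  have : nbhs (x + (- x)) U by rewrite subrr.
  move=> /nbhs_add[V1 [V2 [nV1 nV2 h12]]].
  exists (V1 `&` [set z | V2 (- z)]); split.
    apply: filterI => //; move: nV2; rewrite -scaleN1r => /nbhs_dilate.
    by apply: filterS => z; rewrite /= scaleN1r.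
  move=> w c w' c' Ww Ww' [/= Vw _] [/= _ Vw']; apply: ltW.
  apply: (hU (w - w')); first exact: subspaceB.
  by rewrite scalerBl addrACA -opprD; apply: h12.
have [V hV] := choice nearx.
have nVk k : nbhs x [set z | forall j, (j <= k)%N -> V j z].
  elim: k => [|k IH].
    by apply: filterS (proj1 (hV 0%N)) => z Vz j; rewrite leqn0 => /eqP ->.
  apply: filterS (filterI IH (proj1 (hV k.+1))) => z [h1 h2] j.
  by rewrite leq_eqVlt => /predU1P[->//|]; rewrite ltnS; apply: h1.
(* The k-th point lies in all of [V 0, ..., V k], so for m <= n the m-th and n-th points share [V m]
   and their coordinates differ by at most 1/(m+1). *)
have pick (k : nat) : exists p : X * K, W p.1 /\ forall j, (j <= k)%N -> V j (p.1 + p.2 *: v).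
  have [y Vy [w [c [Ww ey]]]] := hx _ (nVk k).
  by exists (w, c); split=> //=; rewrite -ey.
have [p hp] := choice pick.
have [l hl] : exists l, forall n, N ((p n).2 - l) <= 2 * n.+1%:R^-1.
  apply: (snorm_complete hN) => m n mn.
  by apply: (proj2 (hV m) (p m).1 _ (p n).1); try apply: (proj2 (hp _)); try apply: (proj1 (hp _)).
exists (x - l *: v), l; split; last by rewrite subrK.
apply: cW => B; rewrite -scaleNr => /nbhs_add[V1 [V2 [nV1 /nbhs_scale[d [V3 [d0 nV3 h3]]] h12]]].
(* A coordinate [c] of a point in [V k] satisfies N(c - l) <= 1/(k+1) + 2/(k+1), which is below [d]
   for this [k]. *)
have [k hk] := inv_nat_lt (divr_gt0 d0 (ltr0n R 4)).
have [y [V1y Vky] [w [c [Ww ey]]]] := hx _ (filterI nV1 (nVk k)).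
exists w; split=> //.
have -> : w = y + (- c) *: v by rewrite ey scaleNr addrK.
apply: h12 => //; apply: h3; last exact: nbhs_singleton.
rewrite -opprD (snormN hN) -[c](subrK (p k).2) -addrA.
have h1 : N (c - (p k).2) <= k.+1%:R^-1.
  apply: (proj2 (hV k) w _ (p k).1) => //; first by case: (hp k).
    by rewrite -ey; apply: Vky.
  by case: (hp k) => _; apply.
have := snormD hN (c - (p k).2) ((p k).2 - l); have := hl k; move: hk h1.
set t := k.+1%:R^-1; lra.
Qed.

Lemma lin_span_subspace (A : set X) : is_subspace (lin_span A).
Proof.
split; first by exists 0%N, (fun i : 'I_0 => 0), (fun=> 0); rewrite big_ord0; split=> // -[].
move=> a x y [n [v [c [Av ->]]]] [m [u [b [Au ->]]]].
exists (n + m)%N, (fun i => match fintype.split i with inl j => v j | inr j => u j end),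
  (fun i => match fintype.split i with inl j => a * c j | inr j => b j end); split.
  by move=> i; case: splitP.
rewrite big_split_ord /= scaler_sumr; congr (_ + _); apply: eq_bigr => i _.
  by rewrite -[lshift _ _]/(unsplit (inl i)) unsplitK scalerA.
by rewrite -[rshift _ _]/(unsplit (inr i)) unsplitK.
Qed.

Lemma sub_lin_span (A : set X) : A `<=` lin_span A.
Proof.
move=> x Ax; exists 1%N, (fun=> x), (fun=> 1).
by rewrite big_ord_recl big_ord0 addr0 scale1r.
Qed.

Lemma lin_span_min (A W : set X) : is_subspace W -> A `<=` W -> lin_span A `<=` W.
Proof.
move=> sW AW x [n [v [c [Av ->]]]].
by apply: subspace_sum => // i; apply: subspaceZ => //; apply: AW.
Qed.

Lemma zero_subspace : is_subspace [set 0 : X].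
Proof. by split=> // a x y -> ->; rewrite scaler0 addr0. Qed.

(** Starting from the closed subspace {0}, the vectors are adjoined one at a time with
    [subspace_plus_closed]. *)
Lemma fin_span_closed n (v : 'I_n -> X) :
  closed [set 0 : X] -> closed (lin_span (range v)).
Proof.
move=> c0; suff [W [sW cW hW]] : exists W, [/\ is_subspace W, closed W & W = lin_span (range v)].
  by rewrite -hW.
elim: n v => [|n IH] v.
  exists [set 0]; split=> //; first exact: zero_subspace.
  apply/seteqP; split=> [_ ->|x]; first by case: (lin_span_subspace (range v)).
  apply: lin_span_min; first exact: zero_subspace.
  by move=> y [[i hi]].
have [W [sW cW hW]] := IH (v \o lift ord0).
exists (subspace_plus W (v ord0)); split.
- exact: subspace_plus_subspace.
- exact: subspace_plus_closed.
apply/seteqP; split.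
  move=> x [w [c [Ww ->]]]; rewrite addrC.
  apply: (proj2 (lin_span_subspace _)); first by apply: sub_lin_span; exists ord0.
  move: Ww; rewrite hW; apply: lin_span_min; first exact: lin_span_subspace.
  by move=> _ [i _ <-]; apply: sub_lin_span; exists (lift ord0 i).
apply: lin_span_min; first exact: subspace_plus_subspace.
move=> _ [i _ <-]; have [j ->|->] := unliftP ord0 i.
  exists (v (lift ord0 j)), 0; rewrite scale0r addr0; split=> //.
  by rewrite hW; apply: sub_lin_span; exists j.
by exists 0, 1; rewrite add0r scale1r; split=> //; case: sW.
Qed.

(** A finite-dimensional span containing a dense set is closed, hence equals the whole space. *)
Lemma dense_subspace_infdim (Z : set X) : closed [set 0 : X] ->
  infinite_dimensional [set: X] -> dense Z -> infinite_dimensional Z.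
Proof.
move=> c0 infX dZ n v hv; apply: (infX n v) => x _.
apply: (@fin_span_closed n v c0) => B nB.
have [y [By Zy]] := dZ (B°) (ex_intro _ x nB) (@open_interior _ B).
by exists y; split; [apply: hv | apply: interior_subset].
Qed.

End TopologicalModule.

(** * Polynomials in a linear operator *)

Definition linear_op (K : pzRingType) (V : lmodType K) (T : V -> V) : Prop :=
  forall (a : K) x y, T (a *: x + y) = a *: T x + T y.

Definition poly_op (K : fieldType) (V : lmodType K) (T : V -> V)
  (p : {poly K}) (x : V) : V := \sum_(i < size p) p`_i *: iter i T x.

Section PolyOp.
Variables (K : fieldType) (V : lmodType K) (T : V -> V) (hT : linear_op T).
Implicit Types (p q : {poly K}) (x y : V).

Lemma linear_op0 : T 0 = 0.
Proof. by have := hT (-1) 0 0; rewrite scaler0 addr0 scaleN1r addNr. Qed.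
Lemma linear_opD x y : T (x + y) = T x + T y.
Proof. by have := hT 1 x y; rewrite !scale1r. Qed.
Lemma linear_opZ a x : T (a *: x) = a *: T x.
Proof. by have := hT a x 0; rewrite linear_op0 !addr0. Qed.
Lemma linear_opB x y : T (x - y) = T x - T y.
Proof. by rewrite -scaleN1r linear_opD linear_opZ scaleN1r. Qed.
Lemma linear_op_sum n (f : 'I_n -> V) : T (\sum_(i < n) f i) = \sum_(i < n) T (f i).
Proof. exact: (big_morph T linear_opD linear_op0). Qed.

Lemma iter_linear_op n : linear_op (iter n T).
Proof. by elim: n => [|n IH] a x y //=; rewrite IH hT. Qed.

(** Lets polynomials of different sizes be summed over a common index range. *)
Lemma poly_op_widen n p x : (size p <= n)%N ->
  poly_op T p x = \sum_(i < n) p`_i *: iter i T x.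
Proof.
move=> pn; rewrite /poly_op (big_ord_widen n (fun i => p`_i *: iter i T x)) // big_mkcond /=.
apply: eq_bigr => i _; case: ltnP => // h.
by rewrite nth_default // scale0r.
Qed.

Lemma poly_op_linl a p q x :
  poly_op T (a *: p + q) x = a *: poly_op T p x + poly_op T q x.
Proof.
set n := maxn (size p) (size q).
rewrite (@poly_op_widen n p) ?leq_maxl// (@poly_op_widen n q) ?leq_maxr//.
rewrite (@poly_op_widen n); last first.
  rewrite (leq_trans (size_polyD _ _))// geq_max leq_maxr andbT.
  by rewrite (leq_trans (size_scale_leq _ _)) ?leq_maxl.
rewrite scaler_sumr -big_split; apply: eq_bigr => i _ /=.
by rewrite coefD coefZ scalerDl scalerA.
Qed.

Lemma poly_op0 x : poly_op T 0 x = 0.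
Proof. by rewrite /poly_op size_poly0 big_ord0. Qed.
Lemma poly_opD p q x : poly_op T (p + q) x = poly_op T p x + poly_op T q x.
Proof. by have := poly_op_linl 1 p q x; rewrite !scale1r. Qed.
Lemma poly_opZ a p x : poly_op T (a *: p) x = a *: poly_op T p x.
Proof. by have := poly_op_linl a p 0 x; rewrite !addr0 poly_op0 addr0. Qed.
Lemma poly_opN p x : poly_op T (- p) x = - poly_op T p x.
Proof. by rewrite -[- p]scaleN1r poly_opZ scaleN1r. Qed.
Lemma poly_opC c x : poly_op T c%:P x = c *: x.
Proof. by rewrite (@poly_op_widen 1) ?size_polyC ?leq_b1// big_ord_recl big_ord0 addr0 coefC. Qed.
Lemma poly_op1 x : poly_op T 1 x = x.
Proof. by rewrite poly_opC scale1r. Qed.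

Lemma poly_opXn n x : poly_op T 'X^n x = iter n T x.
Proof.
rewrite /poly_op size_polyXn big_ord_recr /= coefXn eqxx scale1r big1 ?add0r// => i _.
by rewrite coefXn (ltn_eqF (ltn_ord i)) scale0r.
Qed.

Lemma poly_op_linr p : linear_op (poly_op T p).
Proof.
move=> a x y; rewrite /poly_op scaler_sumr -big_split /=; apply: eq_bigr => i _.
by rewrite iter_linear_op scalerDr !scalerA mulrC.
Qed.

Lemma poly_opXM p x : poly_op T ('X * p) x = T (poly_op T p x).
Proof.
rewrite linear_op_sum (@poly_op_widen (size p).+1); last first.
  by rewrite mulrC; have [->|p0] := eqVneq p 0; rewrite ?mul0r ?size_poly0// size_mulX.
rewrite big_ord_recl /= coefXM eqxx scale0r add0r; apply: eq_bigr => i _.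
by rewrite coefXM /= linear_opZ.
Qed.

Lemma poly_opXnM n p x : poly_op T ('X^n * p) x = iter n T (poly_op T p x).
Proof. by elim: n => [|n IH]; rewrite ?mul1r// exprS -mulrA poly_opXM IH. Qed.

Lemma poly_op_sum n (f : 'I_n -> {poly K}) x :
  poly_op T (\sum_(i < n) f i) x = \sum_(i < n) poly_op T (f i) x.
Proof. by apply: (big_morph (fun p => poly_op T p x)) => [p q|]; rewrite ?poly_opD ?poly_op0. Qed.

Lemma poly_opM p q x : poly_op T (p * q) x = poly_op T p (poly_op T q x).
Proof.
rewrite -{1}[p]coefK poly_def mulr_suml poly_op_sum; apply: eq_bigr => i _.
by rewrite -scalerAl poly_opZ poly_opXnM.
Qed.

Lemma poly_op_comm p x : poly_op T p (T x) = T (poly_op T p x).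
Proof. by rewrite -poly_opXM mulrC poly_opM -['X]expr1 poly_opXn. Qed.

Lemma poly_opXsubC z p x : poly_op T (('X - z%:P) * p) x = T (poly_op T p x) - z *: poly_op T p x.
Proof. by rewrite mulrBl poly_opD poly_opXM poly_opN mul_polyC poly_opZ. Qed.

End PolyOp.

(** Return times of x to the preimage under g of a neighbourhood of g x are return times of g x to
    that neighbourhood. *)
Lemma FRec_semiconj (F : set (set nat)) (Y Y' : topologicalType) (T : Y -> Y)
    (T' : Y' -> Y') (g : Y -> Y') (x : Y) :
  (forall A B, F A -> A `<=` B -> F B) -> continuous g ->
  (forall y, g (T y) = T' (g y)) -> FRec F T x -> FRec F T' (g x).
Proof.
move=> upF cg gT rx U nU.
have gI n : iter n T' (g x) = g (iter n T x).
  by elim: n => //= n ->; rewrite gT.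
by apply: upF (rx _ (cg x U nU)) _ => n /=; rewrite gI.
Qed.

Lemma fam_I_up A B : fam_I A -> A `<=` B -> fam_I B.
Proof. by move=> iA AB fB; apply: iA; exact: (sub_finite_set AB). Qed.

Lemma FRec_sub (F G : set (set nat)) (Y : topologicalType) (T : Y -> Y) :
  F `<=` G -> FRec F T `<=` FRec G T.
Proof. by move=> FG x rx U nU; apply/FG/rx. Qed.

Lemma infinite_nat_ge (A : set nat) (m : nat) : Defs.infinite_nat A -> exists2 n, (m <= n)%N & A n.
Proof.
move=> iA; apply: contrapT => h; apply: iA; apply: (@sub_finite_set _ _ `I_m) => //.
move=> n An /=; rewrite ltnNge; apply/negP => mn; apply: h; by exists n.
Qed.

(** * Recurrent vectors: eigenvalues and Jordan blocks *)

Section Recurrence.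
Variables (R : realType) (K : numFieldType) (N : K -> R) (hN : scalar_norm N).
Variables (X : topologicalLmodType K) (T : X -> X).
Hypotheses (hT : cont_lin_op T) (X_T1 : closed [set 0 : X]).
Let linT : linear_op T := proj1 hT.

Lemma continuous_lincomb (Y : topologicalType) (c : K) (f g : Y -> X) :
  continuous f -> continuous g -> continuous (fun y => c *: f y + g y).
Proof.
move=> cf cg y U /nbhs_add[V [W [/(nbhs_dilate hN) nV nW h]]].
have nf : nbhs y [set z | V (c *: f z)] by exact: cf nV.
have ng : nbhs y [set z | W (g z)] by exact: cg nW.
by apply: filterS (filterI nf ng) => z [/= Vz Wz]; apply: h.
Qed.

Lemma continuous_addl (Y : topologicalType) (f g : Y -> X) :
  continuous f -> continuous g -> continuous (fun y => f y + g y).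
Proof.
move=> cf cg; have := continuous_lincomb (c := 1) cf cg.
by under eq_fun do rewrite scale1r.
Qed.

Lemma continuous_iter (Y : topologicalType) (f : Y -> Y) n :
  continuous f -> continuous (iter n f).
Proof.
move=> cf; elim: n => [|n IH] y U //= nU.
exact: (IH y _ (cf (iter n f y) U nU)).
Qed.

Lemma poly_op_continuous p : continuous (poly_op T p).
Proof.
rewrite /poly_op; elim: (size p) => [|n IH].
  rewrite (_ : (fun _ => _) = fun=> 0); first exact: cst_continuous.
  by apply/funext => x; rewrite big_ord0.
have -> : (fun x => \sum_(i < n.+1) p`_i *: iter i T x) =
   (fun x => p`_n *: iter n T x + \sum_(i < n) p`_i *: iter i T x).
  by apply/funext => x; rewrite big_ord_recr addrC.
by apply: continuous_lincomb => //; apply: continuous_iter; case: hT.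
Qed.

Lemma FRec_poly_op F p x : (forall A B, F A -> A `<=` B -> F B) ->
  FRec F T x -> FRec F T (poly_op T p x).
Proof.
move=> upF; apply: FRec_semiconj => //; first exact: poly_op_continuous.
exact: poly_op_comm.
Qed.

Let rec := FRec fam_I T.

(** Since the set of return times is infinite, it contains a positive one; the trivial return at
    time 0 would carry no information. *)
Lemma rec_return x U : rec x -> nbhs 0 U -> exists n, U (iter n.+1 T x - x).
Proof.
move=> rx /(nbhs_shift x) /rx /(infinite_nat_ge 1)[[//|n] _ /= h].
by exists n.
Qed.

Lemma iter_eigen l x n : T x = l *: x -> iter n T x = l ^+ n *: x.
Proof.
move=> e; elim: n => [|n IH]; first by rewrite scale1r.
by rewrite iterS IH (linear_opZ linT) e scalerA exprSr.
Qed.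

(** Recurrence of x brings the powers l^(n+1) arbitrarily close to 1, whereas their distance to 1 is
    at least |1 - |l||, both for |l| < 1 and for |l| > 1. *)
Lemma recurrent_eigenvalue x l : x != 0 -> T x = l *: x -> rec x -> N l = 1.
Proof.
move=> x0 e rx.
have near (d : R) : 0 < d -> exists n, N (l ^+ n.+1 - 1) < d.
  move=> d0; have [|U nU hU] := coord_small hN (zero_subspace X) X_T1 _ d0 (v := x).
    by move=> /= xe; rewrite xe eqxx in x0.
  have [n hn] := rec_return rx nU; exists n; apply: (hU 0) => //.
  by rewrite add0r scalerBl scale1r -iter_eigen.
have := snorm_ge0 hN l; case: (ltgtP (N l) 1) => // hl l0.
  have [|n] := near (1 - N l); first by lra.
  rewrite (snormB_sym hN); have := snormB_ge hN 1 (l ^+ n.+1).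
  rewrite (snorm1 hN) (snormX hN) exprS => h1 h2.
  have : N l ^+ n <= 1 by apply: exprn_ile1 => //; exact: ltW.
  move=> /(ler_wpM2l l0); lra.
have [|n] := near (N l - 1); first by lra.
have := snormB_ge hN (l ^+ n.+1) 1.
rewrite (snorm1 hN) (snormX hN) exprS => h1 h2.
have : 1 <= N l ^+ n by apply: exprn_ege1; exact: ltW.
move=> /(ler_wpM2l l0); lra.
Qed.

(** Powers of a Jordan block of size two. At n = 0 the truncated [n.-1] is harmless, since the
    factor [n%:R] vanishes. *)
Lemma iter_jordan l x u n : T x = l *: x + u -> T u = l *: u ->
  iter n T x = l ^+ n *: x + (n%:R * l ^+ n.-1) *: u.
Proof.
move=> ex eu; elim: n => [|n IH]; first by rewrite mul0r scale0r scale1r addr0.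
rewrite iterS IH linT (linear_opZ linT) ex eu scalerDr !scalerA -addrA -scalerDl -exprSr.
congr (_ + _ *: _) => /=; case: n {IH} => [|n]; first by rewrite mul0r mul0r addr0 mul1r.
by rewrite -mulrA -exprSr [in RHS]mulrS mulrDl mul1r.
Qed.

(** If u is nonzero, the u-coordinate of T^n x - x modulo the line of x is n l^(n-1), of norm n >= 1
    for positive n, so x never returns close to itself. *)
Lemma recurrent_no_jordan x l u : T x = l *: x + u -> T u = l *: u -> rec x ->
  N l = 1 -> u = 0.
Proof.
move=> ex eu rx l1; apply: contrapT => u0.
have sW := subspace_plus_subspace x (zero_subspace X).
have cW := subspace_plus_closed hN (v := x) (zero_subspace X) X_T1.
(* If u were a multiple of x, nonzero because u is, then x would also be an l-eigenvector and u = T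
   x - l x = 0. *)
have nWu : ~ subspace_plus [set 0] x u.
  move=> [_ [c [/= -> ]]]; rewrite add0r => ue.
  have [c0|c0] := eqVneq c 0; first by apply: u0; rewrite ue c0 scale0r.
  have xe : x = c^-1 *: u by rewrite ue scalerA mulVf// scale1r.
  apply: u0; apply: (addrI (l *: x)); rewrite -ex addr0 {1}xe (linear_opZ linT) eu.
  by rewrite scalerA mulrC -scalerA -xe.
have [U nU hU] := coord_small hN sW cW nWu ltr01.
have [n hn] := rec_return rx nU.
have := hU ((l ^+ n.+1 - 1) *: x) (n.+1%:R * l ^+ n).
rewrite (snormM hN) (snormX hN) l1 expr1n mulr1 (snorm_nat hN) ltNge ler1n /=.
have Wx : subspace_plus [set 0] x ((l ^+ n.+1 - 1) *: x).
  by exists 0, (l ^+ n.+1 - 1); rewrite add0r.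
move=> /(_ Wx); have -> : (l ^+ n.+1 - 1) *: x + (n.+1%:R * l ^+ n) *: u = iter n.+1 T x - x.
  by rewrite (iter_jordan _ ex eu) scalerBl scale1r addrAC.
by move=> /(_ hn).
Qed.

(* Splitting off one factor X - z of (X - z) q: u = q(T) x is a z-eigenvector, and q(z) <> 0 for
   lack of Jordan blocks, so q(T) kills x - u / q(z). *)
Lemma recurrent_split_span (r : seq K) x : rec x ->
  poly_op T (\prod_(z <- r) ('X - z%:P)) x = 0 ->
  lin_span [set y | y != 0 /\ exists l, N l = 1 /\ T y = l *: y] x.
Proof.
set E := (X in lin_span X).
elim: r x => [|z s IH] x rx.
  rewrite big_nil poly_op1 => ->; by case: (lin_span_subspace E).
rewrite big_cons; set q := \prod_(_ <- _) _ => h.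
set u := poly_op T q x.
have [u0|u0] := eqVneq u 0; first exact: IH.
have eu : T u = z *: u.
  by move: h; rewrite poly_opXsubC// => /eqP; rewrite subr_eq0 => /eqP.
have ru p : rec (poly_op T p x) by apply: FRec_poly_op => //; exact: fam_I_up.
have z1 : N z = 1 by apply: recurrent_eigenvalue eu (ru q).
have [g hg] : exists g, q - q.[z]%:P = g * ('X - z%:P).
  by apply/factor_theorem; rewrite /root !hornerE subrr.
have qz : q.[z] != 0.
  (* If q(z) = 0, then q = g (X - z), and y = g(T) x is recurrent with T y = z y + u and T u = z u:
     a Jordan block. *)
  apply/eqP => qz0; move: hg; rewrite qz0 subr0 => hg.
  have := @recurrent_no_jordan (poly_op T g x) z u _ eu (ru g) z1.
  rewrite /u hg mulrC poly_opXsubC// addrC subrK => /(_ erefl) /eqP.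
  by rewrite -poly_opXsubC// mulrC -hg -/u (negbTE u0).
(* The remainder x - u / q(z) is written as a polynomial in T applied to x: this makes it recurrent,
   and it is killed by q because q g (X - z) = g (X - z) q. *)
have -> : x = q.[z]^-1 *: u + poly_op T (- q.[z]^-1 *: (g * ('X - z%:P))) x.
  rewrite poly_opZ -hg poly_opD poly_opN poly_opC -/u scalerBr scalerA mulNr mulVf//.
  by rewrite scaleNr scaleN1r opprK addNKr.
have [_ sE] := lin_span_subspace E; apply: sE.
  by apply: sub_lin_span; split => //; exists z.
apply: IH; first exact: ru.
rewrite -poly_opM// -/q -scalerAr poly_opZ.
have -> : q * (g * ('X - z%:P)) = g * (('X - z%:P) * q) by ring.
by rewrite poly_opM// h (linear_op0 (poly_op_linr linT g)) scaler0.
Qed.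

End Recurrence.

(** * The moduli of the real and complex numbers as scalar norms *)

Section RealComplete.
Import numFieldNormedType.Exports.

Lemma real_seq_complete (R : realType) (c : nat -> R) :
  (forall m n, (m <= n)%N -> `|c m - c n| <= m.+1%:R^-1) ->
  exists l, forall n, `|c n - l| <= n.+1%:R^-1.
Proof.
move=> hc; have cc : cauchy (c @ \oo).
  apply: cauchy_exP => e e0; have [k hk] := inv_nat_lt e0.
  exists (c k); exists k => // n /= kn; rewrite /ball /=.
  exact: le_lt_trans (hc _ _ kn) hk.
have := @cauchy_cvg _ (c @ \oo) _ cc; rewrite cvg_ex => -[l hl].
exists l => n; apply/ler_addgt0Pr => e e0.
have /cvgrPdist_lt/(_ e e0)[M _ hM] := hl.
have h1 := hM (maxn M n) (leq_maxl M n); have h2 := hc n (maxn M n) (leq_maxr M n).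
have -> : c n - l = (c n - c (maxn M n)) + (c (maxn M n) - l) by rewrite addrA subrK.
rewrite (le_trans (ler_normD _ _))// lerD//; rewrite distrC; exact: ltW.
Qed.

End RealComplete.

Lemma real_scalar_norm (R : realType) : scalar_norm (fun x : R => `|x|).
Proof.
split.
- exact: normrM.
- exact: ler_normD.
- exact: normrN.
- exact: normr_nat.
- by move=> a /eqP; rewrite normr_eq0 => /eqP.
- by move=> e e0; exists e.
- move=> c /real_seq_complete[l hl]; exists l => n; apply: le_trans (hl n) _.
  by rewrite mulr_natl mulr2n lerDl invr_ge0.
Qed.

Section Complex.
Variable R : realType.
Implicit Type z : R[i].
Import ComplexField.
Local Notation normc := (@ComplexField.Normc.normc R).

Lemma norm_normc z : `|z| = (normc z)%:C%C.
Proof. by []. Qed.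

Lemma normc_real (x : R) : normc x%:C%C = `|x|.
Proof. by rewrite /Normc.normc /= expr0n addr0 sqrtr_sqr. Qed.

Lemma normc_ge_absRe z : `|complex.Re z| <= normc z.
Proof. by rewrite -lecR -norm_normc; exact: normc_ge_Re. Qed.

Lemma normc_ge_absIm z : `|complex.Im z| <= normc z.
Proof.
case: z => a b; rewrite /= -sqrtr_sqr ler_wsqrtr// lerDr; exact: sqr_ge0.
Qed.

Lemma normc_le_ReIm z : normc z <= `|complex.Re z| + `|complex.Im z|.
Proof.
case: z => a b /=; rewrite -[leRHS]ger0_norm ?addr_ge0// -sqrtr_sqr ler_wsqrtr//.
rewrite sqrrD !real_normK ?num_real//.
by have := mulr_ge0 (normr_ge0 a) (normr_ge0 b); rewrite -mulr_natl; lra.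
Qed.

Lemma complex_scalar_norm : scalar_norm (fun z : R[i] => normc z).
Proof.
split.
- exact: Normc.normcM.
- exact: le_normcD.
- exact: normcN.
- by move=> n; rewrite -(rmorph_nat (real_complex R)) normc_real normr_nat.
- exact: Normc.eq0_normc.
- move=> e; rewrite ltcE /= => /andP[/eqP ie re]; exists (complex.Re e) => // z hz.
  by rewrite norm_normc ltcE /= ie eqxx.
- move=> c hc.
  have [l1 h1] : exists l, forall n, `|complex.Re (c n) - l| <= n.+1%:R^-1.
    apply: real_seq_complete => m n /hc; apply: le_trans.
    by rewrite (le_trans _ (normc_ge_absRe _))// raddfB.
  have [l2 h2] : exists l, forall n, `|complex.Im (c n) - l| <= n.+1%:R^-1.
    apply: real_seq_complete => m n /hc; apply: le_trans.
    by rewrite (le_trans _ (normc_ge_absIm _))// raddfB.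
  (* The errors of the real and imaginary parts add up, which accounts for the factor 2 in
     [snorm_complete]. *)
  exists (Complex l1 l2) => n; apply: le_trans (normc_le_ReIm _) _.
  rewrite mulr_natl mulr2n; apply: lerD; [move: (h1 n)|move: (h2 n)].
    by case: (c n).
  by case: (c n).
Qed.

Lemma normc1P z : (normc z = 1) <-> (`|z| = 1).
Proof. by rewrite norm_normc; split=> [->//|[]]. Qed.

End Complex.

(** * Complexification of a real topological module *)

Lemma continuous_scale (R : realType) (K : numFieldType) (N : K -> R)
    (hN : scalar_norm N) (X : topologicalLmodType K) (Y : topologicalType)
    (f : Y -> K) (g : Y -> X) :
  (forall y (e : R), 0 < e -> nbhs y [set z | N (f z - f y) < e]) -> continuous g ->
  continuous (fun y => f y *: g y).
Proof.
move=> cf cg y U /(nbhs_scale hN)[d [V [d0 nV h]]].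
have ng : nbhs y [set z | V (g z)] by exact: cg nV.
by apply: filterS (filterI (cf y d d0) ng) => z [/= hz Vz]; apply: h.
Qed.

Lemma continuous_pairing (Y X X' : topologicalType) (f : Y -> X) (g : Y -> X') :
  continuous f -> continuous g -> continuous (fun y => (f y, g y)).
Proof.
move=> cf cg y.
by apply: (@cvg_pair _ _ _ _ (nbhs (f y)) (nbhs (g y))); [exact: cf|exact: cg].
Qed.

(** A separate name for the product, so that its module structure over [R[i]] does not compete with
    the coordinatewise one over [R]. The pair (x, y) stands for x + i y. *)
Definition complexification (R : realType) (X : topologicalLmodType R) : Type := (X * X)%type.

Section Complexification.
Variables (R : realType) (X : topologicalLmodType R).
Local Notation XC := (complexification X).

HB.instance Definition _ := GRing.Zmodule.copy XC (X * X)%type.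
HB.instance Definition _ := Topological.copy XC (X * X)%type.

Definition cscale (a : R[i]) (p : XC) : XC :=
  (complex.Re a *: p.1 - complex.Im a *: p.2, complex.Im a *: p.1 + complex.Re a *: p.2).

Fact cscaleA a b p : cscale a (cscale b p) = cscale (a * b) p.
Proof.
case: a b p => [a a'] [b b'] [x y]; rewrite /cscale /=; congr (_, _).
  by rewrite !scalerBr !scalerDr !scalerBl scalerDl !scalerA !opprD addrACA.
by rewrite !scalerBr !scalerDr scalerDl scalerBl !scalerA addrACA; congr (_ + _); rewrite addrC.
Qed.

Fact cscale1 : left_id 1 cscale.
Proof.
by move=> [x y]; rewrite /cscale /= !scale1r !scale0r subr0 add0r.
Qed.

Fact cscaleDr : right_distributive cscale +%R.
Proof.
move=> [a b] [x y] [x' y']; rewrite /cscale /=; congr (_, _) => /=.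
  by rewrite !scalerDr opprD addrACA.
by rewrite !scalerDr addrACA.
Qed.

Fact cscaleDl p : {morph cscale^~ p : a b / a + b}.
Proof.
case: p => x y [a b] [a' b']; rewrite /cscale /=; congr (_, _) => /=.
  by rewrite !scalerDl opprD addrACA.
by rewrite !scalerDl addrACA.
Qed.

HB.instance Definition _ := GRing.Zmodule_isLmodule.Build R[i] XC
  cscaleA cscale1 cscaleDr cscaleDl.

Fact fst_continuousC : continuous (fst : XC -> X).
Proof. by move=> p; exact: cvg_fst. Qed.

Fact snd_continuousC : continuous (snd : XC -> X).
Proof. by move=> p; exact: cvg_snd. Qed.

Fact cadd_continuous : continuous (fun p : XC * XC => p.1 + p.2).
Proof.
have c1 : continuous (fun p : XC * XC => p.1) by move=> p; exact: cvg_fst.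
have c2 : continuous (fun p : XC * XC => p.2) by move=> p; exact: cvg_snd.
have c := @continuous_addl _ _ _ (real_scalar_norm R) X.
apply: (@continuous_pairing _ X X (fun p => p.1.1 + p.2.1) (fun p => p.1.2 + p.2.2)).
  apply: c => p.
    exact: (continuous_comp (c1 p) (@fst_continuousC p.1)).
  exact: (continuous_comp (c2 p) (@fst_continuousC p.2)).
apply: c => p.
  exact: (continuous_comp (c1 p) (@snd_continuousC p.1)).
exact: (continuous_comp (c2 p) (@snd_continuousC p.2)).
Qed.

HB.instance Definition _ := PreTopologicalNmodule_isTopologicalNmodule.Build XC cadd_continuous.

Fact cscale_continuous : continuous (fun z : R[i]^o * XC => z.1 *: z.2).
Proof.
pose Y := (R[i]^o * XC)%type.
have c2 : continuous (fun p : Y => p.2) by move=> p; exact: cvg_snd.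
have cx : continuous (fun p : Y => p.2.1).
  by move=> p; exact: (continuous_comp (c2 p) (@fst_continuousC p.2)).
have cy : continuous (fun p : Y => p.2.2).
  by move=> p; exact: (continuous_comp (c2 p) (@snd_continuousC p.2)).
(* Meant for the real and imaginary parts, which are additive and bounded by the modulus. Balls of
   [R[i]] have radii in [R[i]], hence the coercion of [e]. *)
have near1 (f : R[i] -> R) : (forall a b, f (a - b) = f a - f b) ->
    (forall a, `|f a| <= ComplexField.Normc.normc a) ->
    forall (y : Y) e, 0 < e -> nbhs y [set z : Y | `|f z.1 - f y.1| < e].
  move=> fB fle y e e0; exists ([set b : R[i]^o | `|y.1 - b| < e%:C%C], setT) => /=.
    split; last exact: filterT.
    by exists e%:C%C => [|b]; rewrite /= ?ltcR.
  move=> [b q] /= [hb _]; rewrite -fB -normrN -[- f _]sub0r.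
  have f0 : f 0 = 0 by rewrite -[0]subr0 fB subrr.
  rewrite -f0 -fB sub0r opprB.
  by apply: le_lt_trans (fle _) _; rewrite -ltcR -norm_normc.
have nRe := near1 (@complex.Re R) (raddfB _) (@normc_ge_absRe R).
have nIm := near1 (@complex.Im R) (raddfB _) (@normc_ge_absIm R).
have nImN : forall (y : Y) (e : R), 0 < e ->
    nbhs y [set z : Y | `|- complex.Im z.1 - - complex.Im y.1| < e].
  move=> y e e0; apply: filterS (nIm y e e0) => z /=.
  by rewrite -opprD normrN.
have c := @continuous_addl _ _ _ (real_scalar_norm R) X.
have hN := real_scalar_norm R.
apply: (@continuous_pairing Y X X
  (fun p => complex.Re p.1 *: p.2.1 - complex.Im p.1 *: p.2.2)
  (fun p => complex.Im p.1 *: p.2.1 + complex.Re p.1 *: p.2.2)); apply: c.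
- exact: (continuous_scale hN nRe cx).
- by under eq_fun do rewrite -scaleNr; exact: (continuous_scale hN nImN cy).
- exact: (continuous_scale hN nIm cx).
- exact: (continuous_scale hN nRe cy).
Qed.

HB.instance Definition _ := TopologicalNmodule_isTopologicalLmodule.Build R[i] XC cscale_continuous.


End Complexification.

(** Over the algebraically closed field [R[i]] the polynomial p splits into linear factors, so
    [recurrent_split_span] applies. *)
Lemma complex_recurrent_span (R : realType) (X : topologicalLmodType R[i]) (T : X -> X)
    (p : {poly R[i]}) (x : X) :
  cont_lin_op T -> closed [set 0 : X] -> p != 0 -> FRec fam_I T x ->
  poly_op T p x = 0 -> lin_span (E_complex T) x.
Proof.
move=> hT c0 p0 rx.
have [r ->] := closed_field_poly_normal p; rewrite poly_opZ => /eqP.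
rewrite scaler_eq0 lead_coef_eq0 (negbTE p0) /= => /eqP px.
have := recurrent_split_span (complex_scalar_norm R) hT c0 rx px.
apply: lin_span_min; first exact: lin_span_subspace.
move=> y [y0 [l [/normc1P l1 Ty]]]; apply: sub_lin_span; split=> //.
by exists l.
Qed.

(** * Descent from complex to real scalars *)

Section RealSpectral.
Variables (R : realType) (X : topologicalLmodType R) (T : X -> X).
Hypotheses (hT : cont_lin_op T) (c0 : closed [set 0 : X]).
Local Notation XC := (complexification X).

Definition complexify (p : XC) : XC := (T p.1, T p.2).

Lemma complexify_cont_lin : cont_lin_op complexify.
Proof.
have [lT cT] := hT; split.
  move=> a x y; rewrite /complexify /=; congr (_, _) => /=.
    by rewrite (linear_opD lT) (linear_opB lT) !(linear_opZ lT).
  by rewrite !(linear_opD lT) !(linear_opZ lT).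
apply: continuous_pairing => p.
  exact: (continuous_comp (@fst_continuousC _ _ p) (cT _)).
exact: (continuous_comp (@snd_continuousC _ _ p) (cT _)).
Qed.

Lemma closed0_complexification : closed [set 0 : XC].
Proof.
have -> : [set 0 : XC] = (fst : XC -> X) @^-1` [set 0] `&` (snd : XC -> X) @^-1` [set 0].
  by apply/seteqP; split=> [_ -> //|[x y] [/= -> ->]].
by apply: closedI; apply: preimage_closed => // p _;
  [exact: fst_continuousC|exact: snd_continuousC].
Qed.

Lemma iter_complexify n (p : XC) : iter n complexify p = (iter n T p.1, iter n T p.2).
Proof. by elim: n => [|n IH]; [case: p|rewrite iterS IH]. Qed.

Lemma poly_op_complexify (p : {poly R}) x :
  poly_op complexify (map_poly (real_complex R) p) (x, 0) = (poly_op T p x, 0).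
Proof.
have [lT _] := hT.
have iT0 n : iter n T 0 = 0 by exact: linear_op0 (iter_linear_op lT n).
rewrite /poly_op size_map_poly.
elim: (size p) => [|n IH]; first by rewrite !big_ord0.
rewrite !big_ord_recr /= IH coef_map iter_complexify /= iT0.
by congr (_, _) => /=; rewrite ?scaler0 ?scale0r ?subr0 ?addr0.
Qed.

(** The vector (x, 0) is recurrent for the complexified operator and killed by the same polynomial.
    The pairs with both parts in the real span form a complex subspace [W] containing all unimodular
    eigenvectors, hence also (x, 0). *)
Lemma real_recurrent_span (p : {poly R}) (x : X) : p != 0 -> FRec fam_I T x ->
  poly_op T p x = 0 -> lin_span (E_real T) x.
Proof.
move=> p0 rx px.
have rxC : FRec fam_I complexify ((x, 0) : XC).
  have [lT _] := hT.
  apply: (@FRec_semiconj _ X XC T complexify (fun y => (y, 0))) rx.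
  - exact: fam_I_up.
  - by apply: continuous_pairing; [move=> y; exact: cvg_id|exact: cst_continuous].
  - by move=> y; rewrite /complexify /= (linear_op0 lT).
have pxC : poly_op complexify (map_poly (real_complex R) p) (x, 0) = 0.
  by rewrite poly_op_complexify px.
have pC0 : map_poly (real_complex R) p != 0 by rewrite map_poly_eq0.
have := complex_recurrent_span complexify_cont_lin closed0_complexification pC0 rxC pxC.
set W := [set q : XC | lin_span (E_real T) q.1 /\ lin_span (E_real T) q.2].
have sE := lin_span_subspace (E_real T).
have sW : is_subspace W.
  split; first by split; case: sE.
  move=> a u v [u1 u2] [v1 v2]; split.
    by apply: subspaceD => //; apply: subspaceB => //; apply: subspaceZ.
  by apply: subspaceD => //; apply: subspaceD => //; apply: subspaceZ.
suff EW : E_complex complexify `<=` W by move=> /(lin_span_min sW EW)[].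
move=> [u v] [uv0 [[a b] [/normc1P l1 [/= Tu Tv]]]].
have ab1 : a ^+ 2 + b ^+ 2 = 1.
  by rewrite -[LHS]sqr_sqrtr ?addr_ge0 ?sqr_ge0//; move: l1 => /= ->; rewrite expr1n.
have uv : u != 0 \/ v != 0.
  have [u0|] := eqVneq u 0; last by left.
  by right; apply: contra uv0 => /eqP v0; rewrite u0 v0.
split; apply: sub_lin_span => /=.
  by exists v; split=> //; exists a, b.
(* Multiplying the eigenvector u + i v by -i gives v - i u, so v is the real part of an eigenvector
   too. *)
exists (- u); split; first by rewrite oppr_eq0; tauto.
exists a, b; split=> //; split; first by rewrite Tv scalerN opprK addrC.
have [lT _] := hT.
by rewrite -scaleN1r (linear_opZ lT) Tu !scaleN1r opprB scalerN.
Qed.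

End RealSpectral.

(** * Cyclic subspaces *)

Section Cyclic.
Variables (K : fieldType) (V : lmodType K) (T : V -> V) (hT : linear_op T).

Lemma cyclic_subspace x : is_subspace (range (fun p => poly_op T p x)).
Proof.
split; first by exists 0; rewrite // poly_op0.
by move=> a _ _ [p _ <-] [q _ <-]; exists (a *: p + q); rewrite // poly_op_linl.
Qed.

(** If n vectors spanned the subspace, the n + 1 vectors x, T x, ..., T^n x would be linearly
    dependent, and a dependence relation is a nonzero polynomial annihilating x. *)
Lemma cyclic_infdim x : (forall p, p != 0 -> poly_op T p x != 0) ->
  infinite_dimensional (range (fun p => poly_op T p x)).
Proof.
move=> hx n v hv.
have rowE (i : 'I_n.+1) : exists c : 'I_n -> K, iter i T x = \sum_(j < n) c j *: v j.
  have [|m [u [c [hu ->]]]] := hv (iter i T x); first by exists 'X^i; rewrite // poly_opXn.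
  have hu' k : exists j, v j = u k by have [j _ e] := hu k; exists j.
  have [f hf] := choice hu'.
  (* A combination of elements of [range v] may use a vector repeatedly; its coefficients are
     collected by the chosen index in [v]. *)
  exists (fun j => \sum_(k < m | f k == j) c k).
  rewrite (partition_big f xpredT)//=; apply: eq_bigr => j _.
  by rewrite scaler_suml; apply: eq_bigr => k /eqP <-; rewrite hf.
have [C hC] := choice rowE.
pose A := \matrix_(i < n.+1, j < n) C i j.
have : kermx A != 0.
  by rewrite kermx_eq0 /row_free; apply: contraTneq (rank_leq_col A) => ->; rewrite ltnn.
move=> /rowV0Pn[w /sub_kermxP wA w0].
pose p := \poly_(i < n.+1) w 0 (inord i).
have pi (i : 'I_n.+1) : p`_i = w 0 i by rewrite coef_poly ltn_ord inord_val.
have p0 : p != 0.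
  apply: contra w0 => /eqP p0; apply/eqP/rowP => i.
  by rewrite -pi p0 coef0 mxE.
have /negP := hx p p0; apply; apply/eqP.
rewrite (@poly_op_widen _ _ _ n.+1) ?size_poly//.
under eq_bigr => i _ do rewrite pi hC scaler_sumr.
rewrite exchange_big /= big1// => j _.
under eq_bigr => i _ do rewrite scalerA.
rewrite -scaler_suml; have /rowP/(_ j) := wA; rewrite !mxE.
under eq_bigr => i _ do rewrite mxE.
by move=> ->; rewrite scale0r.
Qed.

End Cyclic.

(** * Finite powers of a topological module *)

Section PtwsNbhs.
Variables (N : nat) (X : topologicalType).

Definition box_nbhs (z : {ptws 'I_N -> X}) : set_system {ptws 'I_N -> X} :=
  [set U | exists2 V : 'I_N -> set X, (forall i, nbhs (z i) (V i)) &
    forall y : {ptws 'I_N -> X}, (forall i, V i (y i)) -> U y].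

(** As the index set is finite, the product topology is the box topology: boxes are finite
    intersections of preimages under projections, and each such preimage contains a box. *)
Lemma nbhs_ptwsE (z : {ptws 'I_N -> X}) : nbhs z = box_nbhs z.
Proof.
have FB : Filter (box_nbhs z).
  split; first by exists (fun=> setT) => // i; exact: filterT.
    move=> P Q [V nV hV] [W nW hW]; exists (fun i => V i `&` W i).
      by move=> i; exact: filterI.
    by move=> y h; split; [apply: hV => i; case: (h i)|apply: hW => i; case: (h i)].
  by move=> P Q PQ [V nV hV]; exists V => // y /hV /PQ.
apply/seteqP; split=> U.
  suff : box_nbhs z --> z by apply.
  apply/cvg_sup => i B [_ [[A oA <-] Az AB]].
  exists (fun j => if j == i then A else setT).
    move=> j; have [->|_] := eqVneq j i; last exact: filterT.
    by apply: open_nbhs_nbhs; split.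
  by move=> y /(_ i); rewrite eqxx => Ayi; apply: AB.
move=> [V nV hV].
have : forall i, nbhs z [set y : {ptws 'I_N -> X} | V i (y i)].
  by move=> i; exact: (@proj_continuous 'I_N (fun=> X) i z _ (nV i)).
by move=> /filter_forall; apply: filterS => y; apply: hV.
Qed.

Lemma continuous_ptws (Y : topologicalType) (f : Y -> {ptws 'I_N -> X}) :
  (forall i, continuous (fun y => f y i)) -> continuous f.
Proof.
move=> cf y U; rewrite nbhs_ptwsE => -[V nV hV].
have : forall i, nbhs y [set z | V i (f z i)] by move=> i; exact: (cf i y _ (nV i)).
move=> /filter_forall; apply: filterS => z hz; exact: hV.
Qed.

End PtwsNbhs.

(** A named copy that carries the topological module structure. It is convertible with
    [{ptws 'I_N -> X}], so results on it apply to [T_N] directly. *)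
Definition powspace (K : numFieldType) (X : topologicalLmodType K) (N : nat) : Type :=
  {ptws 'I_N -> X}.

Section PowSpace.
Variables (R : realType) (K : numFieldType) (nK : K -> R) (hN : scalar_norm nK).
Variables (X : topologicalLmodType K).

Section Structure.
Variable N : nat.
Local Notation XN := (powspace X N).

HB.instance Definition _ := Topological.copy XN {ptws 'I_N -> X}.
HB.instance Definition _ := GRing.Lmodule.copy XN {ptws 'I_N -> X}.

Fact pow_proj_continuous i : continuous (fun z : XN => z i).
Proof. exact: (@proj_continuous 'I_N (fun=> X) i). Qed.

Fact pow_add_continuous : continuous (fun p : XN * XN => p.1 + p.2).
Proof.
apply: continuous_ptws => i y U /nbhs_add[V [W [nV nW h]]].
exists ([set a : XN | V (a i)], [set a : XN | W (a i)]); last by move=> [a b] [/= Va Wb]; exact: h.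
by split; exact: pow_proj_continuous.
Qed.

HB.instance Definition _ := PreTopologicalNmodule_isTopologicalNmodule.Build XN pow_add_continuous.

Fact pow_scale_continuous : continuous (fun z : K^o * XN => z.1 *: z.2).
Proof.
apply: continuous_ptws => i y U nU.
have [[A B] [nA nB] h] := @scale_continuous K X (y.1, y.2 i) U nU.
exists (A, [set a : XN | B (a i)]); last by move=> [a b] [/= Va Wb]; exact: (h (a, b i)).
by split => //; exact: pow_proj_continuous.
Qed.

HB.instance Definition _ := TopologicalNmodule_isTopologicalLmodule.Build K XN pow_scale_continuous.

Lemma pow_sumE n (f : 'I_n -> XN) i : (\sum_(j < n) f j) i = \sum_(j < n) f j i.
Proof. by elim/big_ind2: _ => // u v u' v' <- <-. Qed.

Lemma pow_cont_lin_op (T : X -> X) : cont_lin_op T -> cont_lin_op (@T_N X T N : XN -> XN).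
Proof.
move=> [lT cT]; split; first by move=> a x y; apply/funext => i; rewrite /T_N lT.
apply: continuous_ptws => i y.
exact: (continuous_comp (@pow_proj_continuous i y) (cT _)).
Qed.

Lemma pow_separable : separable X -> separable XN.
Proof.
(* The number [k] encodes a finite list of indices into the dense sequence [u]; the index 0 is used
   past the end of the list. *)
move=> [u du]; pose w (k : nat) : XN := fun i => u (nth 0%N (odflt [::] (unpickle k)) i).
exists w => O [z Oz] oO.
have : nbhs z O by apply: open_nbhs_nbhs.
rewrite nbhs_ptwsE => -[V nV hV].
have ex i : exists k, V i (u k).
  have [y [Vy [k _ e]]] := du (V i)° (ex_intro _ (z i) (nV i)) (@open_interior _ _).
  by exists k; apply: interior_subset; rewrite e.
have [k hk] := choice ex.
exists (w (pickle (codom k))); split; last by eexists.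
apply: hV => i; rewrite /w pickleK /=.
suff -> : nth 0%N (codom k) i = k i by [].
by rewrite (nth_map i) ?size_enum_ord// nth_ord_enum.
Qed.

Lemma pow_F_space : F_space R X -> F_space R XN.
Proof.
move=> [d [[d0 dE] ds dt di [dn dc]]].
pose D (x y : XN) := \sum_(i < N) d (x i) (y i).
have D0 x y : 0 <= D x y by apply: sumr_ge0.
have dD x y i : d (x i) (y i) <= D x y.
  by rewrite /D (bigD1 i)//= lerDl sumr_ge0.
(* Dividing by N + 1 instead of N keeps the bound N e / (N + 1) < e strict, also for N = 0. *)
have Dsmall x y e : (forall i, d (x i) (y i) < e / N.+1%:R) -> 0 < e -> D x y < e.
  move=> h e0; apply: (@le_lt_trans _ _ (\sum_(i < N) e / N.+1%:R)).
    by apply: ler_sum => i _; exact: ltW.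
  rewrite sumr_const card_ord -[_ *+ N]mulr_natl mulrCA.
  by rewrite gtr_pMr// ltr_pdivrMr ?ltr0n// mul1r ltr_nat.
exists D; split.
- split=> // x y; split=> [h|->]; last by rewrite /D big1// => i _; apply/dE.
  apply/funext => i; apply/dE/eqP; rewrite eq_le d0 andbT -h; exact: dD.
- by move=> x y; apply: eq_bigr => i _; exact: ds.
- by move=> x y z; rewrite /D -big_split; apply: ler_sum => i _; exact: dt.
- by move=> x y z; apply: eq_bigr => i _; exact: di.
split.
  move=> x U; rewrite [nbhs x]nbhs_ptwsE; split.
    move=> [V nV hV].
    have ex i : exists e : R, 0 < e /\ [set y | d (x i) y < e] `<=` V i by apply/dn.
    have [e he] := choice ex.
    exists (\big[Num.min/1]_(i < N) e i); split.
      by elim/big_ind: _ => // [a b a0 b0|i _]; [rewrite lt_min a0|case: (he i)].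
    move=> y /= hy; apply: hV => i; apply: (proj2 (he i)) => /=.
    apply: le_lt_trans (dD x y i) _; apply: lt_le_trans hy _.
    exact: bigmin_le.
  move=> [e [e0 he]]; exists (fun i => [set y | d (x i) y < e / N.+1%:R]).
    by move=> i; apply/dn; exists (e / N.+1%:R); split=> //; rewrite divr_gt0 ?ltr0n.
  by move=> y hy; apply: he; apply: Dsmall.
move=> u hu.
have ex i : exists l : X, forall e : R, 0 < e -> exists M : nat, forall n : nat,
    (M <= n)%N -> d (u n i) l < e.
  apply: dc => e /hu[M hM]; exists M => m n mM nM.
  exact: le_lt_trans (dD _ _ i) (hM _ _ mM nM).
have [l hl] := choice ex.
exists (l : XN) => e e0.
have ex2 i : exists M : nat, forall n, (M <= n)%N -> d (u n i) (l i) < e / N.+1%:R.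
  by apply: hl; rewrite divr_gt0 ?ltr0n.
have [M hM] := choice ex2.
exists (\max_(i < N) M i) => n hn; apply: Dsmall => // i; apply: hM.
exact: leq_trans (leq_bigmax i) hn.
Qed.

End Structure.

(** The coordinates at [ord0] of a finite spanning family would span X, as the constant tuples
    show. *)
Lemma pow_infdim N : infinite_dimensional [set: X] ->
  infinite_dimensional [set: powspace X N.+1].
Proof.
move=> infX n v hv; apply: (infX n (fun i => v i ord0)) => x _.
have [m [w [c [hw /(congr1 (fun z : powspace X N.+1 => z ord0))]]]] := hv (fun=> x) I.
rewrite pow_sumE => ->; exists m, (fun j => w j ord0), c; split=> // j.
by have [k _ <-] := hw j; exists k.
Qed.

Lemma pow_sep_inf N : sep_inf_F_space R X -> sep_inf_F_space R (powspace X N.+1).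
Proof.
by move=> [h1 h2 h3]; split; [exact: pow_F_space|exact: pow_separable|exact: pow_infdim].
Qed.

Lemma F_space_closed0 : F_space R X -> closed [set 0 : X].
Proof.
move=> [d [[d0 dE] ds dt di [dn dc]]]; apply: closedP_nbhs => x hx.
apply/dE/eqP; rewrite eq_le d0 andbT leNgt; apply/negP => dx.
have nb : nbhs x [set y | d x y < d x 0] by apply/(dn x _).2; exists (d x 0); split.
have [y /= dxy y0] := hx _ nb.
by move: dxy; rewrite y0 ltxx.
Qed.

Definition pow_inj N (i : 'I_N) (x : X) : powspace X N := fun j => if j == i then x else 0.

Lemma pow_inj_lin N (i : 'I_N) a x y :
  pow_inj i (a *: x + y) = a *: pow_inj i x + pow_inj i y.
Proof.
apply/funext => j; rewrite -[RHS]/(a *: (pow_inj i x j) + pow_inj i y j) /pow_inj.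
by case: ifP; rewrite ?scaler0 ?addr0.
Qed.

Lemma pow_inj_T N (i : 'I_N) (T : X -> X) x : T 0 = 0 ->
  T_N T (pow_inj i x) = pow_inj i (T x).
Proof. by move=> T0; apply/funext => j; rewrite /T_N /pow_inj; case: ifP. Qed.

Lemma pow_inj_eq0 N (i : 'I_N) x : (pow_inj i x == 0) = (x == 0).
Proof.
apply/eqP/eqP => [/(congr1 (fun z : powspace X N => z i))|->].
  by rewrite /pow_inj eqxx.
by apply/funext => j; rewrite /pow_inj; case: ifP.
Qed.

Lemma pow_inj0 N (i : 'I_N) : pow_inj i 0 = 0.
Proof. by apply/eqP; rewrite pow_inj_eq0. Qed.

Lemma pow_injD N (i : 'I_N) x y : pow_inj i (x + y) = pow_inj i x + pow_inj i y.
Proof. by have := pow_inj_lin i 1 x y; rewrite !scale1r. Qed.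

Lemma pow_injZ N (i : 'I_N) a x : pow_inj i (a *: x) = a *: pow_inj i x.
Proof. by have := pow_inj_lin i a x 0; rewrite pow_inj0 !addr0. Qed.

Lemma pow_injB N (i : 'I_N) x y : pow_inj i (x - y) = pow_inj i x - pow_inj i y.
Proof. by rewrite -scaleN1r pow_injD pow_injZ scaleN1r. Qed.

(** Each tuple is the sum of its coordinates placed in their slots, and [pow_inj] is linear. It is
    applied with E and E' the eigenvector sets of T and of [T_N]. *)
Lemma pow_lin_span N (E : set X) (E' : set (powspace X N)) (z : powspace X N) :
  (forall i x, E x -> E' (pow_inj i x)) -> (forall i, lin_span E (z i)) ->
  lin_span E' z.
Proof.
move=> hE hz; have sE := lin_span_subspace E'.
have -> : z = \sum_(i < N) pow_inj i (z i).
  apply/funext => j; rewrite pow_sumE (bigD1 j)//= /pow_inj eqxx big1 ?addr0// => i ij.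
  by rewrite eq_sym (negbTE ij).
apply: subspace_sum => // i.
have [n [v [c [hv ->]]]] := hz i.
have -> : pow_inj i (\sum_(k < n) c k *: v k) = \sum_(k < n) c k *: pow_inj i (v k).
  elim: n v c {hv} => [|n IH] v c; first by rewrite !big_ord0; apply/eqP; rewrite pow_inj_eq0.
  by rewrite !big_ord_recl pow_inj_lin IH.
by apply: subspace_sum => // k; apply: subspaceZ => //; apply: sub_lin_span; exact: hE.
Qed.

End PowSpace.

(** * The dichotomy between cyclic subspaces and spans of eigenvectors *)

Section Dichotomy.
Variables (R : realType) (K : numFieldType) (nK : K -> R) (hN : scalar_norm nK).
Variables (F : set (set nat)) (hF : Furstenberg_family F).
Variable E : forall X : topologicalLmodType K, (X -> X) -> set X.
Hypothesis span_E_rec : forall X : topologicalLmodType K, sep_inf_F_space R X ->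
  forall S : X -> X, cont_lin_op S -> lin_span (E S) `<=` FRec F S.
Hypothesis rec_span_E : forall (X : topologicalLmodType K) (T : X -> X) (p : {poly K}) x,
  cont_lin_op T -> closed [set 0 : X] -> p != 0 -> FRec fam_I T x ->
  poly_op T p x = 0 -> lin_span (E T) x.
Hypothesis E_stable : forall (X : topologicalLmodType K) (T : X -> X) x,
  cont_lin_op T -> E T x -> E T (T x).
Hypothesis E_pow : forall (X : topologicalLmodType K) (T : X -> X) N (i : 'I_N) x,
  cont_lin_op T -> E T x -> E (@T_N X T N : powspace X N -> powspace X N) (pow_inj i x).

(** The abstract [E] stands for [E_real] or [E_complex], so that one argument serves both scalar
    fields. *)
Lemma recurrent_subspace_of_span_E : recurrent_subspace_conclusion R K F.
Proof.
have [Finf Fup _] := hF.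
move=> X sX T cT rT; have [FX _ infX] := sX; have c0 := F_space_closed0 FX.
have [lT contT] := cT.
have [[x [rx hx]]|h] := pselect (exists x, FRec F T x /\ forall p, p != 0 -> poly_op T p x != 0).
  exists (range (fun p => poly_op T p x)); split.
  - exact: cyclic_subspace.
  - exact: cyclic_infdim.
  - move=> _ [p _ <-]; exists ('X * p) => //; exact: poly_opXM.
  - move=> N z hz.
    have ex i : exists p, poly_op T p x = z i by have [p _ e] := hz i; exists p.
    have [p hp] := choice ex.
    pose g y : {ptws 'I_N.+1 -> X} := fun i => poly_op T (p i) y.
    have -> : z = g x by apply/funext => i; rewrite /g hp.
    apply: (@FRec_semiconj F X {ptws 'I_N.+1 -> X} T (@T_N X T N.+1) g x Fup _ _ rx).
      by apply: continuous_ptws => i; exact: (poly_op_continuous hN).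
    by move=> y; apply/funext => i; rewrite /T_N /g poly_op_comm.
(* In the remaining case every F-recurrent vector has a nonzero annihilating polynomial; it is
   recurrent because members of F are infinite. *)
have FE : FRec F T `<=` lin_span (E T).
  move=> x rx; have [p [p0 px]] : exists p, p != 0 /\ poly_op T p x = 0.
    apply: contrapT => hp; apply: h; exists x; split=> // p p0; apply/eqP => px.
    by apply: hp; exists p.
  exact: rec_span_E cT c0 p0 (FRec_sub Finf rx) px.
exists (lin_span (E T)); split.
- exact: lin_span_subspace.
- apply: (dense_subspace_infdim hN) => // O O0 oO.
  by have [x [Ox rx]] := rT O O0 oO; exists x; split => //; exact: FE.
- move=> _ [n [v [c [hv ->]]]]; rewrite (linear_op_sum lT).
  apply: subspace_sum; first exact: lin_span_subspace.
  move=> i; rewrite (linear_opZ lT); apply: subspaceZ; first exact: lin_span_subspace.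
  by apply: sub_lin_span; exact: E_stable.
- move=> N z hz.
  have H := @span_E_rec (powspace X N.+1) (pow_sep_inf N sX) _ (pow_cont_lin_op N.+1 cT).
  have Hz : lin_span (E (@T_N X T N.+1 : powspace X N.+1 -> powspace X N.+1)) z.
    apply: (pow_lin_span _ hz) => i x Ex; exact: E_pow.
  exact: (H z Hz).
Qed.

End Dichotomy.

Lemma recurrent_subspace_RC_of_span_E (R : realType) (F : set (set nat)) :
  Furstenberg_family F -> span_E_in_FRec R F -> recurrent_subspace_RC R F.
Proof.
move=> hF [hR hC]; split.
  apply: (recurrent_subspace_of_span_E (real_scalar_norm R) hF
    (E := fun X T => E_real T)) => //.
  - by move=> X T p x cT c0 p0; exact: real_recurrent_span.
  - move=> X T x [lT cT] [y [xy [a [b [ab [Tx Ty]]]]]].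
    exists (T y); split; last first.
      exists a, b; split=> //.
      split; first by rewrite {1}Tx (linear_opB lT) !(linear_opZ lT).
      by rewrite {1}Ty (linear_opD lT) !(linear_opZ lT).
    (* On the pair (x, y) the operator acts as a rotation; the inverse rotation recovers x and y
       from T x and T y, which therefore cannot both vanish. *)
    have [Tx0|] := eqVneq (T x) 0; last by left.
    right; apply/eqP => Ty0.
    have e1 : x = a *: T x + b *: T y.
      rewrite Tx Ty scalerBr scalerDr !scalerA addrACA -scalerDl [b * a]mulrC addNr.
      by rewrite addr0 -!expr2 ab scale1r.
    have e2 : y = a *: T y - b *: T x.
      rewrite Tx Ty scalerBr scalerDr !scalerA opprB [X in X + _]addrC addrACA -scalerDl.
      by rewrite [b * a]mulrC subrr addr0 -!expr2 ab scale1r.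
    move: e1 e2; rewrite Tx0 Ty0 !scaler0 addr0 subr0 => x0 y0.
    by move: xy; rewrite x0 y0 eqxx; case.
  - move=> X T N i x [lT cT] [y [xy [a [b [ab [Tx Ty]]]]]].
    exists (pow_inj i y); rewrite !pow_inj_eq0; split=> //.
    exists a, b; split=> //; rewrite !pow_inj_T ?(linear_op0 lT)// Tx Ty.
    by rewrite pow_injB pow_injD !pow_injZ.
apply: (recurrent_subspace_of_span_E (complex_scalar_norm R) hF
  (E := fun X T => E_complex T)) => //.
- by move=> X T p x; exact: complex_recurrent_span.
- move=> X T x [lT cT] [x0 [l [l1 Tx]]]; split.
    by rewrite Tx scaler_eq0 negb_or x0 andbT -normr_eq0 l1 oner_eq0.
  by exists l; split=> //; rewrite {1}Tx (linear_opZ lT).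
- move=> X T N i x [lT cT] [x0 [l [l1 Tx]]]; split; first by rewrite pow_inj_eq0.
  by exists l; split=> //; rewrite pow_inj_T ?(linear_op0 lT)// Tx pow_injZ.
Qed.

(** * The concrete families: inclusions and Furstenberg axioms *)

Section NatFamilies.
Implicit Types A B : set nat.

Lemma infinite_natI A : (forall M : nat, exists2 n, (M <= n)%N & A n) -> Defs.infinite_nat A.
Proof.
move=> h /finite_seqP[s As]; have [n] := h (\max_(i <- s) i).+1.
rewrite As /= => + ns; apply/negP; rewrite -ltnNge ltnS.
exact: (@leq_bigmax_seq _ _ xpredT id n ns).
Qed.

Lemma incr_gap (f : nat -> nat) : (forall k, (f k < f k.+1)%N) ->
  forall i j, (i < j)%N -> (f i < f j)%N.
Proof. by move=> h; exact: (homo_ltn ltn_trans h). Qed.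

Lemma incr_range_infinite (f : nat -> nat) : (forall k, (f k < f k.+1)%N) ->
  Defs.infinite_nat (range f).
Proof.
move=> h; apply: infinite_natI => M; exists (f M); last by exists M.
by elim: M => // M IH; exact: leq_ltn_trans IH (h M).
Qed.

Lemma Deltastar_incr A (f : nat -> nat) : (forall k, (f k < f k.+1)%N) -> fam_Deltastar A ->
  exists i j, (i < j)%N /\ A (f j - f i)%N.
Proof.
move=> hf /(_ _ (incr_range_infinite hf))[_ [_ [[i _ <-] [j _ <-] ij hA]]].
exists i, j; split=> //; rewrite ltnNge; apply/negP; rewrite leq_eqVlt => /predU1P[e|ji].
  by rewrite e ltnn in ij.
by have := incr_gap hf ji; rewrite ltnNge ltnW.
Qed.

(** Differences of partial sums of the sequence n are sums over blocks of consecutive indices. *)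
Lemma Deltastar_IPstar : fam_Deltastar `<=` fam_IPstar.
Proof.
move=> A hA n n0; pose f m := (\sum_(0 <= k < m) n k)%N.
have [|i [j [ij]]] := @Deltastar_incr A f _ hA.
  by move=> k; rewrite /f big_nat_recr //= -[ltnLHS]addn0 ltn_add2l.
have -> : (f j - f i = \sum_(k <- index_iota i j) n k)%N.
  by rewrite /f (@big_cat_nat _ _ _ i 0%N j)//= ?addKn// ltnW.
move=> Aij; exists (index_iota i j); split => //; last exact: iota_uniq.
by rewrite -size_eq0 size_iota subn_eq0 -ltnNge.
Qed.

(** If A has arbitrarily long gaps, let f(k+1) = f(k) + m(f(k)), where A misses [m(g), m(g) + g].
    For i <= j, the difference f(j+1) - f(i) = m(f(j)) + (f(j) - f(i)) falls into the gap for g =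
    f(j), so A misses all differences of values of f. *)
Lemma Deltastar_S : fam_Deltastar `<=` fam_S.
Proof.
move=> A hA; apply: contrapT => nS.
have gap (g : nat) : exists m, (0 < m)%N /\ forall n, (m <= n <= m + g)%N -> ~ A n.
  (* A window of length g + 2 leaves room for g + 1 consecutive integers starting at the positive
     number m + 1. *)
  apply: contrapT => h; apply: nS; exists g.+2; split=> // m.
  apply: contrapT => h'; apply: h; exists m.+1; split=> // n hn An; apply: h'.
  by exists n; split=> //; lia.
have [m hm] := choice gap.
pose f k := iter k (fun b => b + m b)%N 0%N.
have fS k : (f k < f k.+1)%N by rewrite /= -[ltnLHS]addn0 ltn_add2l; case: (hm (f k)).
have [i [[|j] [ij]]] := Deltastar_incr fS hA; first by [].
apply: (proj2 (hm (f j))); rewrite /= -/(f j).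
have : (f i <= f j)%N.
  by move: ij; rewrite ltnS leq_eqVlt => /predU1P[->//|/(incr_gap fS)/ltnW].
lia.
Qed.

Lemma count_in_sub A B m N : A `<=` B -> (count_in A m N <= count_in B m N)%N.
Proof.
by move=> AB; apply: leq_sum => k _; case: asboolP => // Ak; case: asboolP => // /(_ (AB _ Ak)).
Qed.

Lemma count_inS A m N : count_in A m N.+1 = (count_in A m N + `[< A (m + N)%N >])%N.
Proof. by rewrite /count_in addnS big_nat_recr ?leq_addr. Qed.

Lemma count_in0 A m : count_in A m 0 = 0%N.
Proof. by rewrite /count_in addn0 big_geq. Qed.

Lemma count_in_tail A n m N :
  (count_in A m N <= count_in (A `&` [set k | (n <= k)%N]) m N + n)%N.
Proof.
(* Strengthened for the induction: a lost element m + N < n forces N < n, and then [minn N n] grows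
   by one as well. *)
suff : (count_in A m N <= count_in (A `&` [set k | (n <= k)%N]) m N + minn N n)%N.
  by move=> h; apply: leq_trans h _; rewrite leq_add2l geq_minr.
elim: N => [|N IH]; first by rewrite !count_in0.
rewrite !count_inS; case: asboolP => [Ak|_] /=; last by lia.
case: asboolP => [_|nk] /=; first by lia.
have : ~~ (n <= m + N)%N by apply/negP => h; apply: nk; split.
lia.
Qed.

Lemma nat_gt_rat (c : rat) : exists n : nat, forall N, (n <= N)%N -> c <= N%:R.
Proof.
exists (Num.bound `|c|) => N hN; apply: le_trans (ler_norm _) _.
apply: ltW; apply: lt_le_trans (archi_boundP _) _ => //.
by rewrite ler_nat.
Qed.

(** Once N >= 2 n / delta, the at most n lost elements cost at most half of the density. The
    threshold is uniform in m, as upper Banach density requires. *)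
Lemma count_in_tail_density A n (delta : rat) : 0 < delta -> exists N1 : nat,
  forall m N, (N1 <= N)%N -> delta * N%:R <= (count_in A m N)%:R ->
  delta / 2 * N%:R <= (count_in (A `&` [set k | (n <= k)%N]) m N)%:R.
Proof.
move=> d0; have [N1 hN1] := nat_gt_rat (2 / delta * n%:R).
exists N1 => m N /hN1; rewrite -[2 / delta * _]mulrA [delta^-1 * _]mulrC mulrA ler_pdivrMr//.
move=> h1 h2.
have : (count_in A m N)%:R <= (count_in (A `&` [set k | (n <= k)%N]) m N)%:R + n%:R :> rat.
  by rewrite -natrD ler_nat count_in_tail.
lra.
Qed.

(** Each block of length g meets A, so [0, N) contains at least the integer part of N/g elements of
    A, and this is at least N/(2g) when N >= g. *)
Lemma S_Dunder : fam_S `<=` fam_Dunder.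
Proof.
move=> A [g [g0 hA]]; exists (2 * g)%:R^-1; first by rewrite invr_gt0 ltr0n muln_gt0.
exists g => N gN.
have blk k : (k <= count_in A 0 (k * g))%N.
  elim: k => // k IH; have [n [/andP[n1 n2] An]] := hA (k * g)%N.
  have -> : count_in A 0 (k.+1 * g) =
      (count_in A 0 (k * g) + \sum_(k * g <= i < k.+1 * g) (`[< A i >] : nat))%N.
    by rewrite /count_in !add0n (@big_cat_nat _ _ _ (k * g)%N)//= leq_mul2r leqnSn orbT.
  rewrite -addn1 leq_add// (big_rem n) /=; last by rewrite mem_index_iota; lia.
  by rewrite asboolT.
have h : (N %/ g <= count_in A 0 N)%N.
  apply: leq_trans (blk _) _; rewrite /count_in !add0n.
  rewrite [leqRHS](@big_cat_nat _ _ _ (N %/ g * g)%N)//= ?leq_addr//.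
  exact: leq_trunc_div.
rewrite mulrC ler_pdivrMr ?ltr0n ?muln_gt0// -natrM ler_nat.
apply: (@leq_trans (N %/ g * (2 * g))); last by rewrite leq_mul2r h orbT.
have := divn_eq N g; have := ltn_pmod N g0.
have : (0 < N %/ g)%N by rewrite divn_gt0.
nia.
Qed.

Lemma Dunder_Dbar : fam_Dunder `<=` fam_Dbar.
Proof.
move=> A [d d0 [N0 h]]; exists d => // N1; exists (maxn N0 N1).+1.
by split; [lia|lia|apply: h; lia].
Qed.

Lemma Dbar_BDbar : fam_Dbar `<=` fam_BDbar.
Proof.
move=> A [d d0 h]; exists d => // N0; have [N [h1 h2 h3]] := h N0.
by exists N; split=> //; exists 0%N.
Qed.

Lemma BDbar_I : fam_BDbar `<=` fam_I.
Proof.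
move=> A [d d0 h]; apply: infinite_natI => M; apply: contrapT => hM.
have [N1 hN1] := count_in_tail_density A M d0.
have [N [N1N N0 [m hm]]] := h N1.
have := hN1 m N N1N hm.
suff -> : count_in (A `&` [set k | (M <= k)%N]) m N = 0%N.
  by rewrite leNgt mulr_gt0// ?ltr0n// divr_gt0.
apply: big1 => k _; case: asboolP => // -[Ak Mk].
by case: hM; exists k.
Qed.

Lemma Furstenberg_I : Furstenberg_family fam_I.
Proof.
split=> //; first by move=> A B; exact: fam_I_up.
move=> A n _ iA; apply: infinite_natI => M.
have [k hk Ak] := infinite_nat_ge (maxn M n) iA.
by exists k; [|split=> //=]; lia.
Qed.

Lemma Furstenberg_AP : Furstenberg_family fam_AP.
Proof.
split.
- move=> A h; apply: infinite_natI => M; have [a [d [d0 hd]]] := h M.+1.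
  by exists (a + M * d)%N; [nia|exact: hd].
- by move=> A B h AB k; have [a [d [d0 hd]]] := h k; exists a, d; split=> // j /hd /AB.
- move=> A n n0 h k; have [a [d [d0 hd]]] := h (n + k)%N.
  (* The first n terms of a progression of length n + k are dropped; since d > 0, the other terms
     are at least n. *)
  exists (a + n * d)%N, d; split=> // j jk; split=> /=; last by nia.
  by rewrite -addnA -mulnDl; apply: hd; rewrite ltn_add2l.
Qed.

Lemma Furstenberg_BDbar : Furstenberg_family fam_BDbar.
Proof.
split; first exact: BDbar_I.
  move=> A B [d d0 h] AB; exists d => // N0; have [N [h1 h2 [m h3]]] := h N0.
  exists N; split=> //; exists m; apply: le_trans h3 _.
  by rewrite ler_nat count_in_sub.
move=> A n n0 [d d0 h]; exists (d / 2); first by rewrite divr_gt0.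
move=> N0; have [N1 hN1] := count_in_tail_density A n d0.
have [N [h1 h2 [m h3]]] := h (maxn N0 N1).
by exists N; split=> //; [lia|exists m; apply: hN1 => //; lia].
Qed.

Lemma Furstenberg_Dbar : Furstenberg_family fam_Dbar.
Proof.
split; first by move=> A /Dbar_BDbar /BDbar_I.
  move=> A B [d d0 h] AB; exists d => // N0; have [N [h1 h2 h3]] := h N0.
  by exists N; split=> //; apply: le_trans h3 _; rewrite ler_nat count_in_sub.
move=> A n n0 [d d0 h]; exists (d / 2); first by rewrite divr_gt0.
move=> N0; have [N1 hN1] := count_in_tail_density A n d0.
have [N [h1 h2 h3]] := h (maxn N0 N1).
by exists N; split=> //; [lia|apply: hN1 => //; lia].
Qed.

Lemma Furstenberg_Dunder : Furstenberg_family fam_Dunder.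
Proof.
split; first by move=> A /Dunder_Dbar /Dbar_BDbar /BDbar_I.
  move=> A B [d d0 [N0 h]] AB; exists d => //; exists N0 => N hN.
  by apply: le_trans (h N hN) _; rewrite ler_nat count_in_sub.
move=> A n n0 [d d0 [N0 h]]; exists (d / 2); first by rewrite divr_gt0.
have [N1 hN1] := count_in_tail_density A n d0.
by exists (maxn N0 N1) => N hN; apply: hN1; [|apply: h]; lia.
Qed.

Lemma Furstenberg_S : Furstenberg_family fam_S.
Proof.
split.
- by move=> A /S_Dunder /Dunder_Dbar /Dbar_BDbar /BDbar_I.
- by move=> A B [g [g0 h]] AB; exists g; split=> // m; have [n [hn /AB Bn]] := h m; exists n.
- move=> A n n0 [g [g0 h]]; exists (n + g)%N; split=> [|m]; first lia.
  have [k [hk Ak]] := h (m + n)%N; exists k; split; first lia.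
  by split=> //=; lia.
Qed.

Lemma Furstenberg_IPstar : Furstenberg_family fam_IPstar.
Proof.
have sum_ge (s : seq nat) (f : nat -> nat) c : s != [::] -> (forall k, (c <= f k)%N) ->
    (c <= \sum_(k <- s) f k)%N.
  by case: s => // k s _ h; rewrite big_cons; apply: leq_trans (h k) (leq_addr _ _).
split.
- move=> A h; apply: infinite_natI => M; have [//|s [s0 _ hs]] := h (fun=> M.+1).
  by eexists; [|exact: hs]; apply: ltnW; exact: sum_ge.
- by move=> A B h AB n /h[s [s1 s2 /AB hs]]; exists s.
(* Summing the sequence over disjoint blocks of n0 indices gives terms at least n0. Finite sums of
   block sums are finite sums of the original sequence, and they lie in the required tail. *)
- move=> A n0 n0_gt0 h n npos; pose f k := (\sum_(j <- iota 0 n0) n (k * n0 + j))%N.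
  have fge k : (n0 <= f k)%N.
    rewrite /f -[n0 in (n0 <= _)%N](size_iota 0) -sum1_size.
    by apply: leq_sum => j _; exact: npos.
  have [|s [s0 us As]] := h f; first by move=> k; exact: leq_trans (fge k).
  exists [seq (k * n0 + j)%N | k <- s, j <- iota 0 n0]; split.
  + rewrite -size_eq0 size_allpairs size_iota muln_eq0 size_eq0 (negbTE s0) /=.
    by rewrite -lt0n.
  + apply: allpairs_uniq => //; first exact: iota_uniq.
    move=> [k j] [k' j'] /allpairsP[[a b] /= [_ + [-> ->]]] /allpairsP[[a' b'] /= [_ + [-> ->]]].
    rewrite !mem_iota /= !add0n => bn bn' e.
    have ea : a = a' by have := congr1 (divn^~ n0) e; rewrite !divnMDl// !divn_small// !addn0.
    by move: e; rewrite ea => /addnI ->.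
  + by split; rewrite /= big_allpairs_dep /=; [exact: As|exact: sum_ge].
Qed.

Lemma Furstenberg_Deltastar : Furstenberg_family fam_Deltastar.
Proof.
split.
- move=> A /Deltastar_IPstar; exact: (let: And3 h _ _ := Furstenberg_IPstar in h A).
- by move=> A B h AB C /h[b1 [b2 [h1 h2 h3 /AB h4]]]; exists b1, b2.
- move=> A n n0 hA B iB.
  have nextB (m : nat) : exists b, (m <= b)%N /\ B b.
    by have [b mb Bb] := infinite_nat_ge m iB; exists b.
  have [g hg] := choice nextB.
  (* Thinning B so that consecutive chosen elements are at least n apart makes all positive
     differences at least n. *)
  pose f k := iter k (fun b => g (b + n)%N) (g 0%N).
  have fB k : B (f k) by case: k => [|k]; [case: (hg 0%N)|rewrite /=; case: (hg (f k + n)%N)].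
  have fS k : (f k + n <= f k.+1)%N by case: (hg (f k + n)%N).
  have fS' k : (f k < f k.+1)%N by apply: leq_trans (fS k); lia.
  have [i [[|j] [ij Aij]]] := Deltastar_incr fS' hA; first by [].
  exists (f i), (f j.+1); split=> //; first exact: incr_gap.
  split=> //=; have := fS j; rewrite /= -/(f j).
  have : (f i <= f j)%N.
    by move: ij; rewrite ltnS leq_eqVlt => /predU1P[->//|/(incr_gap fS')/ltnW].
  lia.
Qed.

End NatFamilies.

(** * Bohr sets as sets of return times *)

Section Bohr.
Variable R : realType.
Local Notation normc := (@ComplexField.Normc.normc R).

Definition bohr_set n (l : 'I_n -> R[i]) (e : R) : set nat :=
  [set k | forall i, normc (l i ^+ k - 1) < e].

Lemma iter_sum (K : fieldType) (V : lmodType K) (T : V -> V) n (c : 'I_n -> K) (v : 'I_n -> V) k :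
  linear_op T -> iter k T (\sum_(i < n) c i *: v i) = \sum_(i < n) c i *: iter k T (v i).
Proof.
move=> lT; have lk := iter_linear_op lT k.
by rewrite (linear_op_sum lk); apply: eq_bigr => i _; rewrite (linear_opZ lk).
Qed.

(** For x = sum c_i v_i, the difference S^k x - x is the sum of (l_i^k - 1) c_i v_i, hence small for
    k in a Bohr set. In the real case one takes real parts, which also involves the companions of
    the v_i. *)
Lemma span_E_in_FRec_of_bohr (F : set (set nat)) :
  (forall A B, F A -> A `<=` B -> F B) ->
  (forall n (l : 'I_n -> R[i]) e, (forall i, normc (l i) = 1) -> 0 < e -> F (bohr_set l e)) ->
  span_E_in_FRec R F.
Proof.
move=> upF Fbohr; split=> X sX S cS x [n [v [c [hv ->]]]] U nU.
- have n0 := nbhs0_sub nU.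
  have hN := real_scalar_norm R.
  have ex i : exists q : X * R[i], normc q.2 = 1 /\
      S (v i) = complex.Re q.2 *: v i - complex.Im q.2 *: q.1 /\
      S q.1 = complex.Im q.2 *: v i + complex.Re q.2 *: q.1.
    have [y [_ [a [b [ab [h1 h2]]]]]] := hv i.
    by exists (y, Complex a b); split; rewrite //= ab sqrtr1.
  have [q hq] := choice ex.
  have [V1 [V2 [nV1 nV2 hV]]] : exists V1 V2, [/\ nbhs 0 V1, nbhs 0 V2 &
      forall a b, V1 a -> V2 b -> U (\sum_(i < n) c i *: v i + (a + b))].
    by apply: (@nbhs_add _ X 0 0 [set z | U (_ + z)]); rewrite addr0.
  have [e1 e10 h1] := nbhs0_comb hN (fun i => c i *: v i) nV1.
  have [e2 e20 h2] := nbhs0_comb hN (fun i => c i *: (q i).1) nV2.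
  apply: upF (Fbohr n (fun i => (q i).2) (Num.min e1 e2) _ _) _.
  + by move=> i; case: (hq i).
  + by rewrite lt_min e10.
  + move=> k hk /=.
    (* This is the real part of l^k (v + i y), obtained by iterating the complexified operator on
       its eigenvector. *)
    have iterE i : iter k S (v i) =
        complex.Re ((q i).2 ^+ k) *: v i - complex.Im ((q i).2 ^+ k) *: (q i).1.
      have eC : complexify S (v i, (q i).1) = (q i).2 *: ((v i, (q i).1) : complexification X).
        by have [_ [e3 e4]] := hq i; rewrite /complexify /= e3 e4.
      have := iter_eigen (complexify_cont_lin cS) k eC.
      by rewrite iter_complexify => -[].
    have -> : iter k S (\sum_(i < n) c i *: v i) = \sum_(i < n) c i *: v i +
        (\sum_(i < n) complex.Re ((q i).2 ^+ k - 1) *: (c i *: v i) +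
         \sum_(i < n) (- complex.Im ((q i).2 ^+ k - 1)) *: (c i *: (q i).1)).
      rewrite (iter_sum _ _ _ (proj1 cS)) -!big_split /=; apply: eq_bigr => i _.
      have -> (z : R[i]) : complex.Re (z - 1) = complex.Re z - 1 by case: z.
      have -> (z : R[i]) : complex.Im (z - 1) = complex.Im z by case: z => a b; rewrite /= subr0.
      rewrite iterE scalerBr scalerBl scale1r !scaleNr !scalerA.
      by rewrite addrA addrCA subrr addr0 ![c i * _]mulrC.
    apply: hV; [apply: h1 => i|apply: h2 => i].
      apply: le_lt_trans (normc_ge_absRe _) _.
      by have := hk i; rewrite lt_min => /andP[].
    rewrite normrN; apply: le_lt_trans (normc_ge_absIm _) _.
    by have := hk i; rewrite lt_min => /andP[].
- have n0 := nbhs0_sub nU.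
  have hN := complex_scalar_norm R.
  have ex i : exists l, normc l = 1 /\ S (v i) = l *: v i.
    by have [_ [l [/normc1P l1 Sv]]] := hv i; exists l.
  have [l hl] := choice ex.
  have [e e0 he] := nbhs0_comb hN (fun i => c i *: v i) n0.
  apply: upF (Fbohr n l e _ e0) _; first by move=> i; case: (hl i).
  move=> k hk /=.
  have -> : iter k S (\sum_(i < n) c i *: v i) = \sum_(i < n) c i *: v i +
      \sum_(i < n) (l i ^+ k - 1) *: (c i *: v i).
    rewrite (iter_sum _ _ _ (proj1 cS)) -big_split /=; apply: eq_bigr => i _.
    rewrite (iter_eigen cS k (proj2 (hl i))) scalerBl scale1r addrC subrK !scalerA.
    by rewrite mulrC.
  exact: he.
Qed.

Lemma infinite_pigeonhole (fT : finType) (B : set nat) (g : nat -> fT) :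
  Defs.infinite_nat B -> exists b1 b2, [/\ B b1, B b2, (b1 < b2)%N & g b1 = g b2].
Proof.
move=> iB; apply: contrapT => h; apply: iB.
have injg : {in B &, injective g}.
  move=> a b /set_mem Ba /set_mem Bb e; apply/eqP.
  by case: ltngtP => // ab; case: h; [exists a, b|exists b, a].
have := inj_card_eq injg => /eq_finite_set <-.
exact: finite_finset.
Qed.

(** Among infinitely many b, two tuples (l_i^b) share the same cell of a finite grid; as |l_i| = 1,
    the distance between the two powers of l_i equals |l_i^(b2 - b1) - 1|. *)
Lemma bohr_Deltastar n (l : 'I_n -> R[i]) (e : R) :
  (forall i, normc (l i) = 1) -> 0 < e -> fam_Deltastar (bohr_set l e).
Proof.
move=> l1 e0 B iB.
have [M hM] := inv_nat_lt (divr_gt0 e0 (ltr0n R 2)).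
(* Cells of width 1/(M+1) < e/2 covering [-1, 1], numbered from 0 to 2(M+1); real and imaginary
   parts contribute less than e/2 each. *)
pose box (t : R) : nat := Num.truncn ((t + 1) * M.+1%:R).
have box_lt (t : R) : `|t| <= 1 -> (box t < (2 * M.+1).+1)%N.
  rewrite ler_norml => /andP[t1 t2]; rewrite ltnS -(ler_nat R).
  have h : 0 <= (t + 1) * M.+1%:R by rewrite mulr_ge0 //; lra.
  have /andP[h1 _] := truncn_itv h.
  apply: le_trans h1 _; rewrite natrM ler_wpM2r//; lra.
have box_eq (t t' : R) : `|t| <= 1 -> `|t'| <= 1 -> box t = box t' -> `|t - t'| <= M.+1%:R^-1.
  move=> /ler_normlP[t1 t2] /ler_normlP[t1' t2'] eb.
  have M0 : 0 < M.+1%:R :> R by rewrite ltr0n.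
  have h : 0 <= (t + 1) * M.+1%:R by rewrite mulr_ge0 //; lra.
  have h' : 0 <= (t' + 1) * M.+1%:R by rewrite mulr_ge0 //; lra.
  have /andP[h1 h2] := truncn_itv h; have /andP[h3 h4] := truncn_itv h'.
  rewrite -/(box t) in h1 h2; rewrite -/(box t') -eb in h3 h4.
  rewrite -[leRHS]mul1r ler_pdivlMr// -[X in _ * X](ger0_norm (ltW M0)) -normrM.
  rewrite -[(box t).+1%:R]natr1 in h2; rewrite -[(box t).+1%:R]natr1 in h4.
  rewrite ler_norml; apply/andP; split; lra.
pose g (b : nat) : {ffun 'I_n -> 'I_(2 * M.+1).+1 * 'I_(2 * M.+1).+1} :=
  [ffun i => (inord (box (complex.Re (l i ^+ b))), inord (box (complex.Im (l i ^+ b))))].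
have [b1 [b2 [B1 B2 b12 eg]]] := infinite_pigeonhole g iB.
exists b1, b2; split=> // i.
have lb b : normc (l i ^+ b) = 1 by rewrite (snormX (complex_scalar_norm R)) l1 expr1n.
have reb b : `|complex.Re (l i ^+ b)| <= 1 by rewrite -(lb b) normc_ge_absRe.
have imb b : `|complex.Im (l i ^+ b)| <= 1 by rewrite -(lb b) normc_ge_absIm.
have /ffunP/(_ i) := eg; rewrite !ffunE => -[/(congr1 val)/= eRe /(congr1 val)/= eIm].
rewrite !inordK ?box_lt// in eRe eIm.
have -> : normc (l i ^+ (b2 - b1) - 1) = normc (l i ^+ b2 - l i ^+ b1).
  rewrite -[LHS]mul1r -{1}(lb b1) -(snormM (complex_scalar_norm R)) mulrBr mulr1 -exprD.
  by rewrite subnKC// ltnW.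
apply: le_lt_trans (normc_le_ReIm _) _; rewrite !raddfB /=.
have := box_eq _ _ (reb b2) (reb b1) (esym eRe).
have := box_eq _ _ (imb b2) (imb b1) (esym eIm).
move: hM; set t := M.+1%:R^-1; lra.
Qed.

Lemma bohr_AP n (l : 'I_n -> R[i]) (e : R) :
  (forall i, normc (l i) = 1) -> 0 < e -> fam_AP (bohr_set l e).
Proof.
move=> l1 e0 k; have hN := complex_scalar_norm R.
(* With |l^d - 1| < e/(k+1), the bound |l^(pd) - 1| <= p |l^d - 1| stays below e for all p <= k; k +
   1 avoids a zero denominator. *)
have e'0 : 0 < e / k.+1%:R by rewrite divr_gt0 ?ltr0n.
have [|i [j [ij hd]]] := @Deltastar_incr _ id _ (bohr_Deltastar l1 e'0); first by [].
pose d := (j - i)%N; exists d, d; split; first by rewrite subn_gt0.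
move=> m mk r; rewrite -mulSn mulnC exprM.
have small p : normc ((l r ^+ d) ^+ p - 1) <= p%:R * normc (l r ^+ d - 1).
  elim: p => [|p IH]; first by rewrite expr0 subrr (snorm0 hN) mul0r.
  have -> : (l r ^+ d) ^+ p.+1 - 1 = l r ^+ d * ((l r ^+ d) ^+ p - 1) + (l r ^+ d - 1).
    by rewrite mulrBr mulr1 addrA subrK exprS.
  apply: le_trans (snormD hN _ _) _.
  by rewrite (snormM hN) (snormX hN) l1 expr1n mul1r -natr1 mulrDl mul1r lerD2r.
apply: le_lt_trans (small _) _.
apply: (@le_lt_trans _ _ (k%:R * normc (l r ^+ d - 1))).
  by rewrite ler_wpM2r ?(snorm_ge0 hN)// ler_nat.
have := hd r; rewrite /= ltr_pdivlMr ?ltr0n// -/d -natr1 => h.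
have := snorm_ge0 hN (l r ^+ d - 1); lra.
Qed.

Lemma recurrent_subspace_RC_of_Deltastar (F : set (set nat)) :
  Furstenberg_family F -> fam_Deltastar `<=` F -> recurrent_subspace_RC R F.
Proof.
move=> hF sF; apply: recurrent_subspace_RC_of_span_E => //.
apply: span_E_in_FRec_of_bohr; first by case: hF.
by move=> n l e l1 e0; apply/sF/bohr_Deltastar.
Qed.

End Bohr.

Theorem mainTheorem16 (R : realType) :
  (forall F : set (set nat), Furstenberg_family F -> span_E_in_FRec R F ->
     recurrent_subspace_RC R F)
  /\
  [/\ recurrent_subspace_RC R fam_I,
      recurrent_subspace_RC R fam_AP,
      recurrent_subspace_RC R fam_BDbar,
      recurrent_subspace_RC R fam_Dbar &
      recurrent_subspace_RC R fam_Dunder]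
  /\
  [/\ recurrent_subspace_RC R fam_S,
      recurrent_subspace_RC R fam_IPstar &
      recurrent_subspace_RC R fam_Deltastar].
Proof.
have S_D := Deltastar_S.
have Du_D : fam_Deltastar `<=` fam_Dunder := subset_trans S_D S_Dunder.
have Db_D : fam_Deltastar `<=` fam_Dbar := subset_trans Du_D Dunder_Dbar.
have BD_D : fam_Deltastar `<=` fam_BDbar := subset_trans Db_D Dbar_BDbar.
have I_D : fam_Deltastar `<=` fam_I := subset_trans BD_D BDbar_I.
split; first exact: recurrent_subspace_RC_of_span_E.
(* This family is reached through Bohr sets directly, whereas the others follow from the inclusions
   of [fam_Deltastar]. *)
have AP : recurrent_subspace_RC R fam_AP.
  apply: (recurrent_subspace_RC_of_span_E Furstenberg_AP).
  by apply: span_E_in_FRec_of_bohr; [case: Furstenberg_AP | exact: bohr_AP].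
split; split=> //; apply: recurrent_subspace_RC_of_Deltastar => //.
- exact: Furstenberg_I.
- exact: Furstenberg_BDbar.
- exact: Furstenberg_Dbar.
- exact: Furstenberg_Dunder.
- exact: Furstenberg_S.
- exact: Furstenberg_IPstar.
- exact: Deltastar_IPstar.
- exact: Furstenberg_Deltastar.
Qed.
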